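(* Let $k\in[0,1]$ and let $g(z)=\sum_{n=0}^{\infty}b_nz^n$ and $h(z)=\sum_{n=0}^{\infty}a_nz^n$ be analytic in $\mathbb{D}$ such that $|g'(z)|\le k|h'(z)|$ in $\mathbb{D}$, $\operatorname{Re}h(z)\le1$ in $\mathbb{D}$, and $h(0)=a_0$ is positive. Let $\{\varphi_n(r)\}_{n=1}^{\infty}\in\mathcal{F}$ be a decreasing sequence, let $\Phi_1(r)=\sum_{n=1}^{\infty}\varphi_n(r)$, let $p\in(0,1]$, let $R\in(0,1)$ be the minimal positive root of the equation $1=\frac{2}{p}(1+k)\Phi_1(x)$, and suppose that $$1>\frac{2}{p}(1+k)\Phi_1(r)\quad\text{for all } r\in[0,R).$$ Then $$a_0^p+\sum_{n=1}^{\infty}|a_n|\varphi_n(r)+\sum_{n=1}^{\infty}|b_n|\varphi_n(r)\le1\quad\text{for all } 0\le r\le R.$$ Moreover, the inequality is sharp in the following sense: if $1<\frac{2}{p}(1+k)\Phi_1(x)$ for all $x$ in some interval $(R,R+\epsilon)$ with $\epsilon>0$, then the number $R$ cannot be improved, i.e. for no $R'\in(R,1)$ does the displayed inequality hold for all such pairs $(h,g)$ and all $0\le r\le R'$.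
   Context: $\mathbb{D}=\{z\in\mathbb{C}:|z|<1\}$. Here $\{\varphi_n(r)\}_{n=1}^{\infty}\in\mathcal{F}$ means that the $\varphi_n$ are nonnegative continuous functions on $[0,1)$ such that $\sum_{n=1}^{\infty}\varphi_n(r)$ converges locally uniformly with respect to $r\in[0,1)$. The sequence is decreasing if $\varphi_{n+1}(r)\le\varphi_n(r)$ for every $n\ge1$ and $r\in[0,1)$. *)

(* Defs.v *)
From Stdlib Require Import Reals.
From Coquelicot Require Import Coquelicot.
Open Scope R_scope.

Definition in_disk (z : C) : Prop := Cmod z < 1.

(* f is complex differentiable in the disk, with f(z) = sum_{n>=0} c_n z^n there. *)
Definition analytic_with_coeffs (f : C -> C) (c : nat -> C) : Prop :=
  (forall z, in_disk z -> @ex_derive C_AbsRing C_NormedModule f z) /\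
  (forall z, in_disk z -> @is_pseries C_AbsRing C_NormedModule c z (f z)).

Definition in_unit_interval (r : R) : Prop := 0 <= r < 1.

(* A sequence (phi_n)_{n>=1} is encoded as phi : nat -> R -> R whose term phi 0
   is never used; only the values on [0,1) matter. *)
Definition Phi1 (phi : nat -> R -> R) (r : R) : R :=
  Series (fun n => phi (S n) r).

Definition class_F (phi : nat -> R -> R) : Prop :=
  (forall n, (1 <= n)%nat ->
     (forall r, in_unit_interval r -> 0 <= phi n r) /\
     continuous_on in_unit_interval (phi n)) /\
  (forall r, in_unit_interval r -> ex_series (fun n => phi (S n) r)) /\
  (* Locally uniform convergence; the limit in CVU_dom is the pointwise limit
     of the partial sums, i.e. Phi1 phi. *)
  (forall r0, in_unit_interval r0 ->
     exists delta, 0 < delta /\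
       CVU_dom (fun N r => sum_n (fun n => phi (S n) r) N)
               (fun r => in_unit_interval r /\ Rabs (r - r0) < delta)).

Definition decreasing_seq (phi : nat -> R -> R) : Prop :=
  forall n r, (1 <= n)%nat -> in_unit_interval r -> phi (S n) r <= phi n r.

(* a_0 is a positive real number, so it equals Re (a 0). *)
Definition admissible_pair (k : R) (h g : C -> C) (a b : nat -> C) : Prop :=
  analytic_with_coeffs h a /\
  analytic_with_coeffs g b /\
  (forall z, in_disk z -> Cmod (C_derive g z) <= k * Cmod (C_derive h z)) /\
  (forall z, in_disk z -> Re (h z) <= 1) /\
  h (RtoC 0) = a 0%nat /\ Im (a 0%nat) = 0 /\ 0 < Re (a 0%nat).

(* Series returns a default value on divergent series, so convergence of both
   series (of nonnegative terms) is part of the inequality. *)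
Definition bohr_inequality (p : R) (phi : nat -> R -> R) (a b : nat -> C)
    (r : R) : Prop :=
  ex_series (fun n => Cmod (a (S n)) * phi (S n) r) /\
  ex_series (fun n => Cmod (b (S n)) * phi (S n) r) /\
  Rpower (Re (a 0%nat)) p
    + Series (fun n => Cmod (a (S n)) * phi (S n) r)
    + Series (fun n => Cmod (b (S n)) * phi (S n) r) <= 1.

(* F is only meaningful on [0,1), so its roots are sought in (0,1). *)
Definition minimal_positive_root (F : R -> R) (x0 : R) : Prop :=
  0 < x0 < 1 /\ 1 = F x0 /\ (forall x, 0 < x < 1 -> 1 = F x -> x0 <= x).

(* Main.v *)
Require Import Defs.
From Stdlib Require Import Reals Lra Lia Classical FunctionalExtensionality.
From Coquelicot Require Import Coquelicot.
Open Scope R_scope.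

(** Write [al] for [a_0].  Since [1 - Re h] is nonnegative with mean [1 - al],
    Carathéodory's inequality gives [|a_n| <= 2 (1 - al)] for [n >= 1]
    ([caratheodory]).  For [b] the key fact is
    [sum |b_n| phi_n <= k * 2 (1 - al) * Phi1] ([coefficient_sums]).  Both
    bounds together with [al^p <= 1 - p (1 - al)] ([Rpower_le_affine]) give the
    inequality as soon as [2 (1 + k) Phi1 <= p].  For sharpness, take
    [h = al - 2 (1 - al) z / (1 - z)], [g = k h] with [al] close to one: all the
    coefficient bounds are then equalities ([half_plane_violates]).

    The bound on [b] rests on the following ([sections_dominated]): if
    [|g| <= k |h|] on the disk, then for every [N] the sum of the first [N]
    squares [|g_n|^2] is at most [k^2] times that of the [|h_n|^2].  Indeed
    [g = W h] with [W] analytic and [|W| <= k], and truncating [h] to degree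
    below [N] does not change the first [N] coefficients of [W h], so
    orthogonality on circles applies ([section_contraction]).

    Analyticity of [W] at the zeros of [h] is the delicate point, and it is
    obtained without isolating these zeros.  As long as [h] has a zero
    [zeta] with [|zeta| <= rho], the factor [z - zeta] is divided out of [g] and
    [h] and replaced by its reflection in a circle of radius [s > rho].  This
    leaves [W] unchanged and does not enlarge the norm of [h] on that circle,
    but multiplies [|h(0)|] by at least [s / rho].  As [|h(0)|] is bounded by the
    norm, the process stops ([quotient_by_removal]), and a zero-free [h] is
    bounded below by compactness.

    The only consequence of Cauchy's theorem in use is the mean value
    property.  Means over a circle are limits of means over the vertices of
    regular polygons, and [polygon_step] shows that they hardly depend on the
    radius. *)

(** * Finite sums and limits of complex sequences *)

Fixpoint csum (f : nat -> C) (n : nat) : C :=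
  match n with O => RtoC 0 | S m => (csum f m + f m)%C end.

Fixpoint rsum (f : nat -> R) (n : nat) : R :=
  match n with O => 0 | S m => rsum f m + f m end.

Lemma csum_ext f g n :
  (forall i, (i < n)%nat -> f i = g i) -> csum f n = csum g n.
Proof.
  induction n as [|n IH]; intros H; simpl; [reflexivity|].
  rewrite IH by (intros; apply H; lia). rewrite H by lia. reflexivity.
Qed.

Lemma csum_plus f g n :
  csum (fun i => f i + g i)%C n = (csum f n + csum g n)%C.
Proof. induction n as [|n IH]; simpl; [ring|rewrite IH; ring]. Qed.

Lemma csum_scal c f n : csum (fun i => c * f i)%C n = (c * csum f n)%C.
Proof. induction n as [|n IH]; simpl; [ring|rewrite IH; ring]. Qed.

Lemma csum_const c n : csum (fun _ => c) n = (RtoC (INR n) * c)%C.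
Proof.
  induction n as [|n IH]; [simpl; ring|].
  rewrite S_INR, RtoC_plus. simpl csum. rewrite IH. ring.
Qed.

Lemma csum_telescope f n : csum (fun i => f (S i) - f i)%C n = (f n - f O)%C.
Proof. induction n as [|n IH]; simpl; [ring|rewrite IH; ring]. Qed.

Lemma csum_first f n : csum f (S n) = (f O + csum (fun i => f (S i)) n)%C.
Proof.
  induction n as [|n IH]; [simpl; ring|].
  change (csum f (S (S n))) with (csum f (S n) + f (S n))%C.
  rewrite IH. simpl. ring.
Qed.

Lemma rsum_ext f g n :
  (forall i, (i < n)%nat -> f i = g i) -> rsum f n = rsum g n.
Proof.
  induction n as [|n IH]; intros H; simpl; [reflexivity|].
  rewrite IH by (intros; apply H; lia). rewrite H by lia. reflexivity.
Qed.

Lemma rsum_le f g n :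
  (forall i, (i < n)%nat -> f i <= g i) -> rsum f n <= rsum g n.
Proof.
  induction n as [|n IH]; intros H; simpl; [lra|].
  apply Rplus_le_compat; [apply IH; intros; apply H; lia | apply H; lia].
Qed.

Lemma rsum_plus f g n : rsum (fun i => f i + g i) n = rsum f n + rsum g n.
Proof. induction n as [|n IH]; simpl; [ring|rewrite IH; ring]. Qed.

Lemma rsum_scal c f n : rsum (fun i => c * f i) n = c * rsum f n.
Proof. induction n as [|n IH]; simpl; [ring|rewrite IH; ring]. Qed.

Lemma rsum_const c n : rsum (fun _ => c) n = INR n * c.
Proof.
  induction n as [|n IH]; [simpl; ring|].
  rewrite S_INR. simpl rsum. rewrite IH. ring.
Qed.

Lemma rsum_nonneg f n : (forall i, (i < n)%nat -> 0 <= f i) -> 0 <= rsum f n.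
Proof.
  intros H. replace 0 with (rsum (fun _ => 0) n).
  - now apply rsum_le.
  - rewrite rsum_const. ring.
Qed.

Lemma rsum_first f n : rsum f (S n) = f O + rsum (fun i => f (S i)) n.
Proof.
  induction n as [|n IH]; [simpl; ring|].
  change (rsum f (S (S n))) with (rsum f (S n) + f (S n)).
  rewrite IH. simpl. ring.
Qed.

Lemma rsum_mono f n m :
  (forall i, 0 <= f i) -> (n <= m)%nat -> rsum f n <= rsum f m.
Proof.
  intros H Hnm. induction Hnm as [|m Hnm IH]; [lra|].
  simpl. specialize (H m). lra.
Qed.

Lemma sum_n_rsum (f : nat -> R) n : sum_n f n = rsum f (S n).
Proof.
  induction n as [|n IH].
  - rewrite sum_O. simpl. ring.
  - rewrite sum_Sn, IH. reflexivity.
Qed.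

Lemma sum_n_csum (f : nat -> C) n :
  @sum_n C_AbelianMonoid f n = csum f (S n).
Proof.
  induction n as [|n IH].
  - rewrite sum_O. simpl. ring.
  - rewrite sum_Sn, IH. reflexivity.
Qed.

Lemma Cmod_csum f n : Cmod (csum f n) <= rsum (fun i => Cmod (f i)) n.
Proof.
  induction n as [|n IH]; simpl.
  - rewrite Cmod_0. lra.
  - eapply Rle_trans; [apply Cmod_triangle|]. lra.
Qed.

Lemma Re_csum f n : Re (csum f n) = rsum (fun i => Re (f i)) n.
Proof. induction n as [|n IH]; simpl; [reflexivity|]. now rewrite <- IH. Qed.

Lemma Cmod_minus_comm x y : Cmod (x - y) = Cmod (y - x).
Proof. rewrite <- Cmod_opp. f_equal. ring. Qed.

Lemma Cmod_minus_triangle x y z : Cmod (x - z) <= Cmod (x - y) + Cmod (y - z).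
Proof.
  replace (x - z)%C with ((x - y) + (y - z))%C by ring. apply Cmod_triangle.
Qed.

Lemma Cmod_le_plus x y : Cmod x <= Cmod y + Cmod (x - y).
Proof.
  replace x with (y + (x - y))%C at 1 by ring. apply Cmod_triangle.
Qed.

Lemma Cmod_le_Re_Im z : Cmod z <= Rabs (Re z) + Rabs (Im z).
Proof.
  replace z with (RtoC (Re z) + RtoC (Im z) * Ci)%C at 1.
  - eapply Rle_trans; [apply Cmod_triangle|].
    rewrite Cmod_mult, !Cmod_R, Cmod_Ci. lra.
  - destruct z as [x y]. unfold RtoC, Ci, Cplus, Cmult. simpl.
    f_equal; ring.
Qed.

Lemma im_le_Cmod z : Rabs (Im z) <= Cmod z.
Proof.
  generalize (Rmax_Cmod z). intros H.
  eapply Rle_trans; [apply Rmax_r | exact H].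
Qed.

Lemma Cminus_eq_0 (x y : C) : (x - y)%C = RtoC 0 -> x = y.
Proof. intros H. replace x with ((x - y) + y)%C by ring. rewrite H. ring. Qed.

(** Convergence is measured by the modulus of the difference, so that it
    reduces to real sequences and to the order of [R]. *)
Definition clim (u : nat -> C) (l : C) : Prop :=
  is_lim_seq (fun n => Cmod (u n - l)) 0.

Lemma squeeze_0 (u v : nat -> R) :
  (forall n, 0 <= u n <= v n) -> is_lim_seq v 0 -> is_lim_seq u 0.
Proof.
  intros H Hv. apply is_lim_seq_le_le with (fun _ => 0) v; auto.
  apply is_lim_seq_const.
Qed.

Lemma clim_unique u l l' : clim u l -> clim u l' -> l = l'.
Proof.
  intros H H'. apply Cminus_eq_0. apply Cmod_eq_0.
  apply Rle_antisym; [|apply Cmod_ge_0].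
  assert (K := is_lim_seq_plus' _ _ _ _ H H').
  assert (K0 := is_lim_seq_le (fun _ => Cmod (l - l')) _ (Cmod (l - l')) _
    (fun n => Rle_trans _ _ _ (Cmod_minus_triangle l (u n) l')
        (Rplus_le_compat_r _ _ _ (Req_le _ _ (Cmod_minus_comm l (u n)))))
    (is_lim_seq_const _) K).
  simpl in K0. lra.
Qed.

Lemma clim_ext u v l : (forall n, u n = v n) -> clim u l -> clim v l.
Proof.
  intros H. apply is_lim_seq_ext. intros n. now rewrite H.
Qed.

Lemma clim_const c : clim (fun _ => c) c.
Proof.
  apply is_lim_seq_ext with (fun _ => 0); [|apply is_lim_seq_const].
  intros _. replace (c - c)%C with (RtoC 0) by ring. now rewrite Cmod_0.
Qed.

Lemma clim_plus u v l m :
  clim u l -> clim v m -> clim (fun n => u n + v n)%C (l + m)%C.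
Proof.
  intros H H'. apply squeeze_0 with
    (fun n => Cmod (u n - l) + Cmod (v n - m)).
  - intros n. split; [apply Cmod_ge_0|].
    replace (u n + v n - (l + m))%C with ((u n - l) + (v n - m))%C by ring.
    apply Cmod_triangle.
  - replace 0 with (0 + 0) by ring. now apply is_lim_seq_plus'.
Qed.

Lemma clim_scal c u l : clim u l -> clim (fun n => c * u n)%C (c * l)%C.
Proof.
  intros H. apply is_lim_seq_ext with (fun n => Cmod c * Cmod (u n - l)).
  - intros n. rewrite <- Cmod_mult. f_equal. ring.
  - replace (Finite 0) with (Rbar_mult (Cmod c) 0) by (simpl; f_equal; ring).
    now apply is_lim_seq_scal_l.
Qed.

Lemma clim_incr_1 u l : clim u l <-> clim (fun n => u (S n)) l.
Proof. unfold clim. apply (is_lim_seq_incr_1 (fun n => Cmod (u n - l))). Qed.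

Lemma clim_bound u l B : clim u l -> (forall n, Cmod (u n) <= B) -> Cmod l <= B.
Proof.
  intros H HB.
  assert (K : is_lim_seq (fun n => B + Cmod (u n - l)) (B + 0)).
  { apply is_lim_seq_plus'; [apply is_lim_seq_const|exact H]. }
  assert (K0 := is_lim_seq_le (fun _ => Cmod l) _ (Cmod l) _
    (fun n => Rle_trans _ _ _ (Cmod_le_plus l (u n))
        (Rplus_le_compat _ _ _ _ (HB n) (Req_le _ _ (Cmod_minus_comm l (u n)))))
    (is_lim_seq_const _) K).
  simpl in K0. lra.
Qed.

Lemma clim_components u (x y : R) :
  is_lim_seq (fun n => Re (u n)) x -> is_lim_seq (fun n => Im (u n)) y ->
  clim u (x, y).
Proof.
  intros Hx Hy.
  assert (D : forall v (a : R), is_lim_seq v a ->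
             is_lim_seq (fun n => Rabs (v n - a)) 0).
  { intros v a Hv. apply -> is_lim_seq_abs_0.
    replace 0 with (a - a) by ring.
    apply is_lim_seq_minus'; [exact Hv|apply is_lim_seq_const]. }
  apply squeeze_0 with
    (fun n => Rabs (Re (u n) - x) + Rabs (Im (u n) - y)).
  - intros n. split; [apply Cmod_ge_0|].
    replace (Re (u n) - x) with (Re (u n - (x, y))) by reflexivity.
    replace (Im (u n) - y) with (Im (u n - (x, y))) by reflexivity.
    apply Cmod_le_Re_Im.
  - replace 0 with (0 + 0) by ring. apply is_lim_seq_plus'; now apply D.
Qed.

(** * Power series on the unit disk *)

(** The radius of convergence is at least one. *)
Definition subgeometric (c : nat -> C) : Prop :=
  forall t, 0 < t < 1 -> exists B, forall n, Cmod (c n) * t ^ n <= B.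

Definition partial (c : nat -> C) (z : C) (n : nat) : C :=
  csum (fun i => c i * z ^ i)%C n.

(** The sum of the series, as a total function: real and imaginary parts are
    limits in [R], whose value is arbitrary where the series diverges. *)
Definition ev (c : nat -> C) (z : C) : C :=
  (real (Lim_seq (fun n => Re (partial c z n))),
   real (Lim_seq (fun n => Im (partial c z n)))).

Definition shift (c : nat -> C) (n : nat) : C := c (S n).

Definition dcoef (c : nat -> C) (n : nat) : C := (RtoC (INR (S n)) * c (S n))%C.

Lemma Series_ge_rsum (a : nat -> R) n :
  (forall i, 0 <= a i) -> ex_series a -> rsum a n <= Series a.
Proof.
  intros Ha Hs.
  apply Rle_trans with (rsum a (S n)); [apply rsum_mono; auto|].
  rewrite <- sum_n_rsum.
  apply (is_lim_seq_incr_compare (sum_n a) (Series a)).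
  - exact (Series_correct _ Hs).
  - intros m. rewrite sum_Sn. unfold plus; simpl. specialize (Ha (S m)). lra.
Qed.

Lemma subgeometric_ex_series c s :
  subgeometric c -> 0 <= s < 1 -> ex_series (fun n => Cmod (c n) * s ^ n).
Proof.
  intros Hc Hs. set (t := (1 + s) / 2).
  assert (Ht : 0 < t < 1) by (unfold t; lra).
  destruct (Hc t Ht) as [B HB].
  apply (@ex_series_le R_AbsRing R_CompleteNormedModule) with (fun n => B * (s / t) ^ n).
  - intros n. change (Rabs (Cmod (c n) * s ^ n) <= B * (s / t) ^ n).
    rewrite Rabs_pos_eq
      by (apply Rmult_le_pos; [apply Cmod_ge_0|apply pow_le; lra]).
    replace (Cmod (c n) * s ^ n) with (Cmod (c n) * t ^ n * (s / t) ^ n).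
    + apply Rmult_le_compat_r; [|apply HB].
      apply pow_le. apply Rdiv_le_0_compat; lra.
    + rewrite Rmult_assoc, <- Rpow_mult_distr. f_equal. f_equal. field. lra.
  - apply (ex_series_scal_l B (fun n => (s / t) ^ n)). apply ex_series_geom.
    rewrite Rabs_pos_eq by (apply Rdiv_le_0_compat; lra).
    apply (Rmult_lt_reg_r t); [lra|]. unfold Rdiv.
    rewrite Rmult_assoc, Rinv_l by lra. unfold t. lra.
Qed.

Lemma subgeometric_sum_bound c s :
  subgeometric c -> 0 <= s < 1 ->
  exists B, 0 <= B /\ forall n, rsum (fun i => Cmod (c i) * s ^ i) n <= B.
Proof.
  intros Hc Hs.
  assert (Hp : forall i, 0 <= Cmod (c i) * s ^ i).
  { intros i. apply Rmult_le_pos; [apply Cmod_ge_0|apply pow_le; lra]. }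
  assert (H := fun n => Series_ge_rsum _ n Hp (subgeometric_ex_series c s Hc Hs)).
  eexists; split; [|exact H].
  exact (H O).
Qed.

Lemma ev_correct c z :
  subgeometric c -> Cmod z < 1 -> clim (partial c z) (ev c z).
Proof.
  intros Hc Hz.
  assert (Hs := subgeometric_ex_series c (Cmod z) Hc (conj (Cmod_ge_0 z) Hz)).
  assert (K : forall p : C -> R, (forall a b, p (a + b)%C = p a + p b) ->
     p (RtoC 0) = 0 ->
     (forall a, Rabs (p a) <= Cmod a) ->
     is_lim_seq (fun n => p (partial c z n))
       (real (Lim_seq (fun n => p (partial c z n))))).
  { intros p Hadd H0 Hle.
    assert (E : ex_series (fun n => p (c n * z ^ n)%C)).
    { apply (@ex_series_le R_AbsRing R_CompleteNormedModule)
        with (fun n => Cmod (c n) * Cmod z ^ n); [|exact Hs].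
      intros n. change (Rabs (p (c n * z ^ n)%C) <= Cmod (c n) * Cmod z ^ n).
      rewrite <- Cmod_pow, <- Cmod_mult. apply Hle. }
    assert (L := Series_correct _ E).
    assert (L' : is_lim_seq (fun n => p (partial c z n))
                  (Series (fun n => p (c n * z ^ n)%C))).
    { apply is_lim_seq_incr_1. eapply is_lim_seq_ext; [|exact L].
      intros n. rewrite sum_n_rsum. unfold partial.
      assert (Q : forall m, rsum (fun i => p (c i * z ^ i)%C) m =
                        p (csum (fun i => c i * z ^ i)%C m)).
      { intros m. induction m as [|m IH]; simpl.
        - now rewrite H0.
        - now rewrite IH, Hadd. }
      apply Q. }
    rewrite (is_lim_seq_unique _ _ L'). exact L'. }
  apply clim_components; apply K; try reflexivity.
  - intros a. apply re_le_Cmod.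
  - intros a. apply im_le_Cmod.
Qed.

Lemma ev_unique c z l :
  subgeometric c -> Cmod z < 1 -> clim (partial c z) l -> ev c z = l.
Proof.
  intros Hc Hz H. eapply clim_unique; [now apply ev_correct|exact H].
Qed.

Lemma subgeometric_shift c : subgeometric c -> subgeometric (shift c).
Proof.
  intros Hc t Ht. destruct (Hc t Ht) as [B HB]. exists (B / t).
  intros n. specialize (HB (S n)). unfold shift.
  apply (Rmult_le_reg_r t); [lra|].
  replace (B / t * t) with B by (field; lra). simpl in HB. lra.
Qed.

Lemma subgeometric_plus c d :
  subgeometric c -> subgeometric d -> subgeometric (fun n => c n + d n)%C.
Proof.
  intros Hc Hd t Ht. destruct (Hc t Ht) as [B HB]. destruct (Hd t Ht) as [B' HB'].
  exists (B + B'). intros n. specialize (HB n). specialize (HB' n).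
  assert (T := Cmod_triangle (c n) (d n)).
  assert (P := pow_le t n). nra.
Qed.

Lemma subgeometric_scal a c :
  subgeometric c -> subgeometric (fun n => a * c n)%C.
Proof.
  intros Hc t Ht. destruct (Hc t Ht) as [B HB].
  exists (Cmod a * B). intros n. rewrite Cmod_mult, Rmult_assoc.
  apply Rmult_le_compat_l; [apply Cmod_ge_0|apply HB].
Qed.

Definition mul_by_z (c : nat -> C) (n : nat) : C :=
  match n with O => RtoC 0 | S m => c m end.

Lemma subgeometric_mul_by_z c : subgeometric c -> subgeometric (mul_by_z c).
Proof.
  intros Hc t Ht. destruct (Hc t Ht) as [B HB].
  exists (Rmax 0 B). intros [|n]; simpl.
  - rewrite Cmod_0. assert (H := Rmax_l 0 B). lra.
  - specialize (HB n). assert (H := Rmax_r 0 B).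
    assert (P : 0 <= Cmod (c n) * t ^ n).
    { apply Rmult_le_pos; [apply Cmod_ge_0|apply pow_le; lra]. }
    nra.
Qed.

(** Each of the [n + 1] terms of [1 + q + ... + q^n] is at least [q^n]. *)
Lemma mul_pow_le q n : 0 <= q < 1 -> INR (S n) * q ^ n * (1 - q) <= 1 - q ^ S n.
Proof.
  intros Hq. induction n as [|n IH].
  - simpl. lra.
  - rewrite S_INR.
    assert (P : 0 <= q ^ S n <= 1).
    { split; [apply pow_le; lra|]. rewrite <- (pow1 (S n)). apply pow_incr. lra. }
    change (q ^ S (S n)) with (q * q ^ S n).
    change (q ^ S n) with (q * q ^ n) in *.
    nra.
Qed.

(** The factor [n + 1] is absorbed by [(t / s)^n] for some [s] between [t] and
    one. *)
Lemma subgeometric_dcoef c : subgeometric c -> subgeometric (dcoef c).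
Proof.
  intros Hc t Ht. set (s := (1 + t) / 2).
  assert (Hs : 0 < s < 1) by (unfold s; lra).
  destruct (subgeometric_shift c Hc s Hs) as [B HB].
  set (q := t / s).
  assert (Hq : 0 <= q < 1).
  { unfold q. split; [apply Rdiv_le_0_compat; lra|].
    apply (Rmult_lt_reg_r s); [lra|]. unfold Rdiv.
    rewrite Rmult_assoc, Rinv_l by lra. unfold s. lra. }
  assert (HB0 : 0 <= B).
  { specialize (HB O). simpl in HB. assert (P := Cmod_ge_0 (shift c 0)). lra. }
  exists (B / (1 - q)). intros n. unfold dcoef. rewrite Cmod_mult, Cmod_R.
  rewrite Rabs_pos_eq by apply pos_INR.
  replace (t ^ n) with (s ^ n * q ^ n).
  2:{ rewrite <- Rpow_mult_distr. f_equal. unfold q. field. lra. }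
  specialize (HB n). unfold shift in HB.
  assert (M := mul_pow_le q n Hq).
  assert (P : 0 <= q ^ S n) by (apply pow_le; lra).
  assert (P' : 0 <= INR (S n) * q ^ n).
  { apply Rmult_le_pos; [apply pos_INR|apply pow_le; lra]. }
  apply (Rmult_le_reg_r (1 - q)); [lra|].
  replace (B / (1 - q) * (1 - q)) with B by (field; lra).
  replace (INR (S n) * Cmod (c (S n)) * (s ^ n * q ^ n) * (1 - q))
    with ((Cmod (c (S n)) * s ^ n) * (INR (S n) * q ^ n * (1 - q))) by ring.
  assert (P0 : 0 <= INR (S n) * q ^ n * (1 - q)) by (apply Rmult_le_pos; lra).
  nra.
Qed.

Lemma ev_plus c d z :
  subgeometric c -> subgeometric d -> Cmod z < 1 ->
  ev (fun n => c n + d n)%C z = (ev c z + ev d z)%C.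
Proof.
  intros Hc Hd Hz. apply ev_unique; auto using subgeometric_plus.
  eapply clim_ext; [|apply clim_plus; apply ev_correct; eassumption].
  intros n. unfold partial. simpl. rewrite <- csum_plus.
  apply csum_ext. intros. ring.
Qed.

Lemma ev_scal a c z :
  subgeometric c -> Cmod z < 1 -> ev (fun n => a * c n)%C z = (a * ev c z)%C.
Proof.
  intros Hc Hz. apply ev_unique; auto using subgeometric_scal.
  eapply clim_ext; [|apply clim_scal; apply ev_correct; eassumption].
  intros n. unfold partial. simpl. rewrite <- csum_scal.
  apply csum_ext. intros. ring.
Qed.

Lemma ev_shift c z :
  subgeometric c -> Cmod z < 1 -> ev c z = (c O + z * ev (shift c) z)%C.
Proof.
  intros Hc Hz. apply ev_unique; auto. apply clim_incr_1.
  eapply clim_ext;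
    [|apply clim_plus; [apply clim_const|apply clim_scal, ev_correct];
      [apply subgeometric_shift, Hc|exact Hz]].
  intros n. unfold partial, shift. rewrite csum_first, <- csum_scal.
  f_equal; [simpl; ring|]. apply csum_ext. intros. simpl. ring.
Qed.

Lemma ev_mul_by_z c z :
  subgeometric c -> Cmod z < 1 -> ev (mul_by_z c) z = (z * ev c z)%C.
Proof.
  intros Hc Hz. rewrite ev_shift by auto using subgeometric_mul_by_z.
  change (shift (mul_by_z c)) with c. change (mul_by_z c O) with (RtoC 0). ring.
Qed.

Lemma Cmod0_lt_1 : Cmod 0 < 1.
Proof. rewrite Cmod_0. lra. Qed.

Lemma ev_0 c : subgeometric c -> ev c 0 = c O.
Proof. intros Hc. rewrite ev_shift; auto using Cmod0_lt_1. ring. Qed.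

(** * Holomorphic functions with a uniform Taylor bound *)

(** Holomorphy on the closed disk of radius [rho], in a quantitative form: the
    first-order Taylor remainder is uniformly quadratic.  This form passes to
    products and quotients by algebra alone, and it is what sums over
    the vertices of a polygon need. *)
Definition smooth_with (rho : R) (f f' : C -> C) (K : R) : Prop :=
  forall z w, Cmod z <= rho -> Cmod w <= rho ->
    Cmod (f z) <= K /\ Cmod (f' z) <= K /\
    Cmod (f w - f z - f' z * (w - z)) <= K * Cmod (w - z) ^ 2.

Definition smooth (rho : R) (f : C -> C) : Prop :=
  exists f' K, smooth_with rho f f' K.

Lemma smooth_with_lipschitz rho f f' K z w :
  smooth_with rho f f' K -> Cmod z <= rho -> Cmod w <= rho ->
  Cmod (f w - f z) <= K * (1 + 2 * rho) * Cmod (w - z).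
Proof.
  intros H Hz Hw. destruct (H z w Hz Hw) as (_ & Hd & Hr).
  assert (P' := Cmod_ge_0 (f' z)). assert (PK : 0 <= K) by lra.
  replace (f w - f z)%C with
    ((f w - f z - f' z * (w - z)) + f' z * (w - z))%C by ring.
  eapply Rle_trans; [apply Cmod_triangle|]. rewrite Cmod_mult.
  assert (D : Cmod (w - z) <= 2 * rho).
  { eapply Rle_trans; [apply Cmod_triangle|]. rewrite Cmod_opp. lra. }
  assert (P := Cmod_ge_0 (w - z)).
  assert (K * Cmod (w - z) ^ 2 <= K * (2 * rho * Cmod (w - z))).
  { apply Rmult_le_compat_l; [exact PK|]. simpl. rewrite Rmult_1_r.
    apply Rmult_le_compat_r; assumption. }
  assert (Cmod (f' z) * Cmod (w - z) <= K * Cmod (w - z))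
    by (apply Rmult_le_compat_r; assumption).
  lra.
Qed.

Lemma smooth_lipschitz rho f :
  smooth rho f ->
  exists L, 0 < L /\ forall z w, Cmod z <= rho -> Cmod w <= rho ->
    Cmod (f w - f z) <= L * Cmod (w - z).
Proof.
  intros (f' & K & H). exists (Rabs (K * (1 + 2 * rho)) + 1). split.
  - assert (P := Rabs_pos (K * (1 + 2 * rho))). lra.
  - intros z w Hz Hw.
    eapply Rle_trans; [eapply smooth_with_lipschitz; eassumption|].
    apply Rmult_le_compat_r; [apply Cmod_ge_0|].
    assert (P := Rle_abs (K * (1 + 2 * rho))). lra.
Qed.

Lemma smooth_const rho c : smooth rho (fun _ => c).
Proof.
  exists (fun _ => RtoC 0), (Cmod c). intros z w _ _.
  rewrite Cmod_0. replace (c - c - 0 * (w - z))%C with (RtoC 0) by ring.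
  rewrite Cmod_0. assert (P := Cmod_ge_0 c). assert (P' := pow2_ge_0 (Cmod (w - z))).
  split; [|split]; nra.
Qed.

Lemma smooth_id rho : smooth rho (fun z => z).
Proof.
  exists (fun _ => RtoC 1), (1 + rho). intros z w Hz _.
  rewrite Cmod_1. replace (w - z - 1 * (w - z))%C with (RtoC 0) by ring.
  rewrite Cmod_0. assert (P := Cmod_ge_0 z). assert (P' := pow2_ge_0 (Cmod (w - z))).
  split; [|split]; nra.
Qed.

Lemma smooth_plus rho f g :
  smooth rho f -> smooth rho g -> smooth rho (fun z => f z + g z)%C.
Proof.
  intros (f' & K & H) (g' & L & H'). exists (fun z => f' z + g' z)%C, (K + L).
  intros z w Hz Hw. destruct (H z w Hz Hw) as (A1 & A2 & A3).
  destruct (H' z w Hz Hw) as (B1 & B2 & B3).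
  split; [|split].
  - eapply Rle_trans; [apply Cmod_triangle|]. lra.
  - eapply Rle_trans; [apply Cmod_triangle|]. lra.
  - replace (f w + g w - (f z + g z) - (f' z + g' z) * (w - z))%C with
      ((f w - f z - f' z * (w - z)) + (g w - g z - g' z * (w - z)))%C by ring.
    eapply Rle_trans; [apply Cmod_triangle|]. lra.
Qed.

Lemma smooth_mult rho f g :
  smooth rho f -> smooth rho g -> smooth rho (fun z => f z * g z)%C.
Proof.
  intros (f' & K & H) (g' & L & H').
  exists (fun z => f' z * g z + f z * g' z)%C, (K * L * (3 + 2 * rho)).
  intros z w Hz Hw.
  assert (G := smooth_with_lipschitz _ _ _ _ z w H' Hz Hw).
  assert (Gw := proj1 (H' w z Hw Hz)).
  destruct (H z w Hz Hw) as (A1 & A2 & A3).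
  destruct (H' z w Hz Hw) as (B1 & B2 & B3).
  assert (Pf := Cmod_ge_0 (f z)). assert (Pf' := Cmod_ge_0 (f' z)).
  assert (Pg := Cmod_ge_0 (g z)). assert (Pg' := Cmod_ge_0 (g' z)).
  assert (Pz := Cmod_ge_0 z).
  assert (PK : 0 <= K) by lra. assert (PL : 0 <= L) by lra.
  assert (PKL : 0 <= K * L) by nra.
  assert (Pr : 0 <= rho) by lra.
  split; [|split].
  - rewrite Cmod_mult. assert (Cmod (f z) * Cmod (g z) <= K * L).
    { apply Rmult_le_compat; lra. }
    nra.
  - eapply Rle_trans; [apply Cmod_triangle|]. rewrite !Cmod_mult.
    assert (Cmod (f' z) * Cmod (g z) <= K * L) by (apply Rmult_le_compat; lra).
    assert (Cmod (f z) * Cmod (g' z) <= K * L) by (apply Rmult_le_compat; lra).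
    nra.
  - replace (f w * g w - f z * g z - (f' z * g z + f z * g' z) * (w - z))%C with
      ((f w - f z - f' z * (w - z)) * g w + f' z * (w - z) * (g w - g z)
       + f z * (g w - g z - g' z * (w - z)))%C by ring.
    eapply Rle_trans; [apply Cmod_triangle|].
    eapply Rle_trans; [apply Rplus_le_compat_r, Cmod_triangle|].
    rewrite !Cmod_mult. set (D := Cmod (w - z)) in *.
    assert (PD : 0 <= D) by apply Cmod_ge_0.
    assert (T1 : Cmod (f w - f z - f' z * (w - z)) * Cmod (g w)
                 <= (K * D ^ 2) * L).
    { apply Rmult_le_compat; try apply Cmod_ge_0; assumption. }
    assert (T2 : Cmod (f' z) * D * Cmod (g w - g z)
                 <= (K * D) * (L * (1 + 2 * rho) * D)).
    { apply Rmult_le_compat; try apply Cmod_ge_0; try assumption; nra. }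
    assert (T3 : Cmod (f z) * Cmod (g w - g z - g' z * (w - z))
                 <= K * (L * D ^ 2)).
    { apply Rmult_le_compat; try apply Cmod_ge_0; assumption. }
    apply Rle_trans with ((K * D ^ 2) * L + (K * D) * (L * (1 + 2 * rho) * D)
       + K * (L * D ^ 2)); [lra|].
    right. ring.
Qed.

Lemma smooth_scal rho c f : smooth rho f -> smooth rho (fun z => c * f z)%C.
Proof. apply (smooth_mult rho (fun _ => c)), smooth_const. Qed.

Lemma smooth_pow rho n : smooth rho (fun z => z ^ n)%C.
Proof.
  induction n as [|n IH].
  - exact (smooth_const rho 1).
  - exact (smooth_mult rho _ _ (smooth_id rho) IH).
Qed.

Lemma smooth_inv rho f m :
  0 < m -> (forall z, Cmod z <= rho -> m <= Cmod (f z)) ->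
  smooth rho f -> smooth rho (fun z => / f z)%C.
Proof.
  intros Hm Hlow (f' & K & H).
  exists (fun z => - (f' z / (f z * f z)))%C,
    (/ m + K * (/ m * / m) + K * K * (2 + 2 * rho) * (/ m * (/ m * / m))).
  intros z w Hz Hw.
  assert (G := smooth_with_lipschitz _ _ _ _ z w H Hz Hw).
  destruct (H z w Hz Hw) as (A1 & A2 & A3).
  assert (Lz := Hlow z Hz). assert (Lw := Hlow w Hw).
  assert (Nz : f z <> RtoC 0) by (apply Cmod_gt_0; lra).
  assert (Nw : f w <> RtoC 0) by (apply Cmod_gt_0; lra).
  assert (Pf' := Cmod_ge_0 (f' z)).
  assert (Pz := Cmod_ge_0 z).
  assert (PK : 0 <= K) by lra.
  assert (Pr : 0 <= rho) by lra.
  assert (Im : 0 < / m) by now apply Rinv_0_lt_compat.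
  assert (Iz : Cmod (/ f z) <= / m).
  { rewrite Cmod_inv by assumption. apply Rinv_le_contravar; assumption. }
  assert (Iw : Cmod (/ f w) <= / m).
  { rewrite Cmod_inv by assumption. apply Rinv_le_contravar; assumption. }
  assert (Pz' := Cmod_ge_0 (/ f z)). assert (Pw' := Cmod_ge_0 (/ f w)).
  assert (S1 : 0 <= K * (/ m * / m)) by (repeat apply Rmult_le_pos; lra).
  assert (S2 : 0 <= K * K * (2 + 2 * rho) * (/ m * (/ m * / m)))
    by (repeat apply Rmult_le_pos; lra).
  split; [lra|split].
  - rewrite Cmod_opp. replace (f' z / (f z * f z))%C with (f' z * (/ f z * / f z))%C
      by (field; assumption).
    rewrite !Cmod_mult.
    assert (Cmod (f' z) * (Cmod (/ f z) * Cmod (/ f z)) <= K * (/ m * / m)).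
    { apply Rmult_le_compat; try assumption.
      - apply Rmult_le_pos; assumption.
      - apply Rmult_le_compat; assumption. }
    lra.
  - replace (/ f w - / f z - - (f' z / (f z * f z)) * (w - z))%C with
      ((f' z * (w - z) * (f w - f z) + - (f z * (f w - f z - f' z * (w - z))))
        * (/ f w * (/ f z * / f z)))%C by (field; split; assumption).
    rewrite !Cmod_mult. set (D := Cmod (w - z)) in *.
    assert (PD : 0 <= D) by apply Cmod_ge_0.
    assert (PD2 : 0 <= D ^ 2) by apply pow2_ge_0.
    apply Rle_trans with (K * K * (2 + 2 * rho) * D ^ 2 * (/ m * (/ m * / m))).
    + apply Rmult_le_compat.
      * apply Cmod_ge_0.
      * repeat apply Rmult_le_pos; assumption.
      * eapply Rle_trans; [apply Cmod_triangle|]. rewrite Cmod_opp, !Cmod_mult.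
        fold D.
        assert (T2 : Cmod (f' z) * D * Cmod (f w - f z)
                 <= (K * D) * (K * (1 + 2 * rho) * D)).
        { apply Rmult_le_compat; try apply Cmod_ge_0; try assumption; nra. }
        assert (T3 : Cmod (f z) * Cmod (f w - f z - f' z * (w - z))
                 <= K * (K * D ^ 2)).
        { apply Rmult_le_compat; try apply Cmod_ge_0; assumption. }
        eapply Rle_trans; [apply Rplus_le_compat; eassumption|]. right. ring.
      * repeat apply Rmult_le_compat; try assumption.
        apply Rmult_le_pos; assumption.
    + assert (0 <= (/ m + K * (/ m * / m)) * D ^ 2) by nra. nra.
Qed.

Lemma monomial_remainder s z w n :
  Cmod z <= s -> Cmod w <= s ->
  Cmod (w ^ S (S n) - z ^ S (S n) - RtoC (INR (S (S n))) * z ^ S n * (w - z))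
    <= INR (S (S n)) * INR (S n) * s ^ n * Cmod (w - z) ^ 2.
Proof.
  intros Hz Hw. assert (Pz := Cmod_ge_0 z). assert (Pw := Cmod_ge_0 w).
  set (D := Cmod (w - z)).
  assert (PD : 0 <= D ^ 2) by apply pow2_ge_0.
  induction n as [|n IH].
  - replace (w ^ 2 - z ^ 2 - RtoC (INR 2) * z ^ 1 * (w - z))%C
      with ((w - z) * (w - z))%C.
    + rewrite Cmod_mult. fold D. simpl in *. lra.
    + simpl (INR 2). rewrite RtoC_plus. simpl. ring.
  - assert (E : (w ^ S (S (S n)) - z ^ S (S (S n))
        - RtoC (INR (S (S (S n)))) * z ^ S (S n) * (w - z) =
        w * (w ^ S (S n) - z ^ S (S n) - RtoC (INR (S (S n))) * z ^ S n * (w - z))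
        + RtoC (INR (S (S n))) * z ^ S n * ((w - z) * (w - z)))%C).
    { rewrite (S_INR (S (S n))), RtoC_plus. rewrite !(Cpow_S _ (S (S n))).
      rewrite (Cpow_S z (S n)). ring. }
    rewrite E. eapply Rle_trans; [apply Cmod_triangle|].
    rewrite !Cmod_mult, Cmod_R, Cmod_pow. fold D.
    rewrite Rabs_pos_eq by apply pos_INR.
    set (X := INR (S (S n))) in *.
    assert (PX : 0 <= X) by apply pos_INR.
    rewrite (S_INR (S (S n))). fold X.
    assert (EX : X = INR (S n) + 1) by apply S_INR.
    assert (Hp : Cmod z ^ S n <= s ^ S n) by (apply pow_incr; lra).
    assert (Ps : 0 <= s ^ S n) by (apply pow_le; lra).
    assert (Ps' : 0 <= s ^ n) by (apply pow_le; lra).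
    assert (Pn := pos_INR (S n)).
    match goal with |- Cmod w * ?Q + _ <= _ => set (q := Q) in * end.
    assert (Q0 : 0 <= q) by apply Cmod_ge_0.
    assert (T1 : Cmod w * q <= s * (X * INR (S n) * s ^ n * D ^ 2)).
    { apply Rmult_le_compat; assumption. }
    assert (T2 : X * Cmod z ^ S n * (D * D) <= X * s ^ S n * (D * D)).
    { apply Rmult_le_compat_r; [simpl in PD; lra|].
      apply Rmult_le_compat_l; assumption. }
    assert (T3 : 0 <= X * s ^ S n * (D * D)).
    { apply Rmult_le_pos; [apply Rmult_le_pos; assumption|]. simpl in PD. lra. }
    apply Rle_trans with (s * (X * INR (S n) * s ^ n * D ^ 2)
      + X * s ^ S n * (D * D) + X * s ^ S n * (D * D)); [lra|].
    right. replace (INR (S n)) with (X - 1) by lra. simpl. ring.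
Qed.

(** The remainders of the monomials add up to a bound by the second derivative
    of the series, which converges absolutely at [rho]. *)
Lemma smooth_with_ev rho c :
  rho < 1 -> subgeometric c ->
  exists K, smooth_with rho (ev c) (ev (dcoef c)) K.
Proof.
  intros Hr Hc. destruct (Rle_dec 0 rho) as [Hr0|Hr0].
  2:{ exists 0. intros z w Hz. exfalso. assert (P := Cmod_ge_0 z). lra. }
  assert (Hd := subgeometric_dcoef c Hc).
  assert (Hdd := subgeometric_dcoef _ Hd).
  destruct (subgeometric_sum_bound c rho Hc (conj Hr0 Hr)) as (B0 & P0 & H0).
  destruct (subgeometric_sum_bound _ rho Hd (conj Hr0 Hr)) as (B1 & P1 & H1).
  destruct (subgeometric_sum_bound _ rho Hdd (conj Hr0 Hr)) as (B2 & P2 & H2).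
  assert (Bd : forall a B z, subgeometric a ->
     (forall n, rsum (fun i => Cmod (a i) * rho ^ i) n <= B) ->
     Cmod z <= rho -> Cmod (ev a z) <= B).
  { intros a B z Ha HB Hz. apply (clim_bound (partial a z)).
    - apply ev_correct; [assumption|lra].
    - intros n. eapply Rle_trans; [|apply (HB n)].
      eapply Rle_trans; [apply Cmod_csum|]. apply rsum_le. intros i _.
      rewrite Cmod_mult, Cmod_pow. apply Rmult_le_compat_l; [apply Cmod_ge_0|].
      apply pow_incr. split; [apply Cmod_ge_0|exact Hz]. }
  exists (B0 + B1 + B2). intros z w Hz Hw.
  assert (Q0 := Bd c B0 z Hc H0 Hz).
  assert (Q1 := Bd _ B1 z Hd H1 Hz).
  split; [lra|split; [lra|]].
  apply Rle_trans with (B2 * Cmod (w - z) ^ 2).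
  2:{ assert (P := pow2_ge_0 (Cmod (w - z))). nra. }
  (* the constant and linear terms have no remainder, hence the shift by 2 *)
  apply (clim_bound (fun n => partial c w (S (S n)) + (-(1)) * partial c z (S (S n))
            + - (w - z) * partial (dcoef c) z (S n))%C).
  - replace (ev c w - ev c z - ev (dcoef c) z * (w - z))%C with
      (ev c w + (-(1)) * ev c z + - (w - z) * ev (dcoef c) z)%C by ring.
    apply clim_plus; [apply clim_plus|].
    + apply -> (clim_incr_1 (fun n => partial c w (S n))).
      apply -> clim_incr_1. apply ev_correct; [exact Hc|lra].
    + apply clim_scal.
      apply -> (clim_incr_1 (fun n => partial c z (S n))).
      apply -> clim_incr_1. apply ev_correct; [exact Hc|lra].
    + apply clim_scal. apply -> clim_incr_1. apply ev_correct; [exact Hd|lra].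
  - intros n.
    assert (E : (partial c w (S (S n)) + - (1) * partial c z (S (S n)) +
       - (w - z) * partial (dcoef c) z (S n))%C =
       csum (fun i => c (S (S i)) * (w ^ S (S i) - z ^ S (S i)
          - RtoC (INR (S (S i))) * z ^ S i * (w - z)))%C n).
    { unfold partial. rewrite !(csum_first _ (S n)), !(csum_first _ n).
      transitivity (csum (fun i => c (S (S i)) * w ^ S (S i))%C n
        + - (1) * csum (fun i => c (S (S i)) * z ^ S (S i))%C n
        + - (w - z) * csum (fun i => dcoef c (S i) * z ^ S i)%C n)%C.
      - unfold dcoef at 1. simpl (INR 1). simpl (_ ^ 0)%C. simpl (_ ^ 1)%C. ring.
      - rewrite <- !csum_scal, <- !csum_plus. apply csum_ext.
        intros i _. unfold dcoef. ring. }
    rewrite E. eapply Rle_trans; [apply Cmod_csum|].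
    apply Rle_trans with
      (Cmod (w - z) ^ 2 * rsum (fun i => Cmod (dcoef (dcoef c) i) * rho ^ i) n).
    + rewrite <- rsum_scal. apply rsum_le. intros i _.
      rewrite Cmod_mult. unfold dcoef. rewrite !Cmod_mult, !Cmod_R.
      rewrite !Rabs_pos_eq by apply pos_INR.
      eapply Rle_trans.
      * apply Rmult_le_compat_l; [apply Cmod_ge_0|].
        apply (monomial_remainder rho); assumption.
      * right. ring.
    + rewrite Rmult_comm. apply Rmult_le_compat_r; [apply pow2_ge_0|apply H2].
Qed.

Lemma smooth_ev rho c : rho < 1 -> subgeometric c -> smooth rho (ev c).
Proof. intros Hr Hc. eexists. now apply smooth_with_ev. Qed.

(** * Averages over roots of unity *)

Definition root (M j : nat) : C :=
  let t := 2 * PI * INR j / INR M in (cos t, sin t).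

(** The mean over the circle of radius [rho], as a limit over inscribed regular
    polygons; it plays the part of the integral in Cauchy's theorem. *)
Definition circle_mean (rho : R) (u : C -> R) (l : R) : Prop :=
  is_lim_seq
    (fun M => rsum (fun j => u (RtoC rho * root M j)%C) M / INR M) l.

Lemma root_S M j : (0 < M)%nat -> root M (S j) = (root M 1 * root M j)%C.
Proof.
  intros HM. assert (P : 0 < INR M) by (apply lt_0_INR; exact HM).
  unfold root, Cmult. cbn [fst snd].
  replace (2 * PI * INR (S j) / INR M) with
    (2 * PI * INR 1 / INR M + 2 * PI * INR j / INR M)
    by (rewrite (S_INR j); simpl; field; lra).
  rewrite cos_plus, sin_plus. f_equal; ring.
Qed.

Lemma Cmod_root M j : Cmod (root M j) = 1.
Proof.
  unfold root, Cmod. cbn [fst snd].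
  set (t := 2 * PI * INR j / INR M). assert (H := sin2_cos2 t).
  unfold Rsqr in H. replace (cos t ^ 2 + sin t ^ 2) with 1 by (simpl; lra).
  apply sqrt_1.
Qed.

Lemma root_0 M : root M 0 = RtoC 1.
Proof.
  unfold root. replace (2 * PI * INR 0 / INR M) with 0.
  - now rewrite cos_0, sin_0.
  - simpl. unfold Rdiv. ring.
Qed.

Lemma root_period M : (0 < M)%nat -> root M M = RtoC 1.
Proof.
  intros HM. assert (P : 0 < INR M) by (apply lt_0_INR; exact HM).
  unfold root. replace (2 * PI * INR M / INR M) with (2 * PI) by (field; lra).
  now rewrite cos_2PI, sin_2PI.
Qed.

Lemma root_1_neq M : (3 <= M)%nat -> root M 1 <> RtoC 1.
Proof.
  intros HM E. apply (f_equal snd) in E. unfold root in E. cbn [snd RtoC] in E.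
  assert (P : 3 <= INR M) by (replace 3 with (INR 3) by (simpl; ring); now apply le_INR).
  assert (P0 := PI_RGT_0).
  assert (0 < sin (2 * PI * INR 1 / INR M)).
  { apply sin_gt_0.
    - simpl. apply Rdiv_lt_0_compat; lra.
    - simpl. apply (Rmult_lt_reg_r (INR M)); [lra|].
      unfold Rdiv. rewrite Rmult_assoc, Rinv_l by lra. nra. }
  lra.
Qed.

Lemma is_lim_seq_inv_INR : is_lim_seq (fun M => / INR M) 0.
Proof.
  replace (Finite 0) with (Rbar_inv p_infty) by reflexivity.
  apply is_lim_seq_inv; [apply is_lim_seq_INR|discriminate].
Qed.

Lemma root_1_lim : is_lim_seq (fun M => Cmod (root M 1 - 1)) 0.
Proof.
  assert (L : is_lim_seq (fun M => 2 * PI * INR 1 / INR M) 0).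
  { unfold Rdiv. replace (Finite 0) with (Rbar_mult (2 * PI * INR 1) 0)
      by (simpl; f_equal; ring).
    apply is_lim_seq_scal_l, is_lim_seq_inv_INR. }
  assert (T : clim (fun M => root M 1) (cos 0, sin 0)).
  { apply clim_components; simpl Re; simpl Im.
    - apply (is_lim_seq_continuous cos _ 0); [|exact L].
      apply continuity_cos.
    - apply (is_lim_seq_continuous sin _ 0); [|exact L].
      apply continuity_sin. }
  rewrite cos_0, sin_0 in T. exact T.
Qed.

(** One step of length [s - r] between concentric circles changes the sum of
    [f] over the [M]-gon by the radial derivative.  The tangential derivative
    is the radial one times [i r], and it sums to almost nothing because the
    increments around the polygon telescope; so the change is of order
    [|root M 1 - 1|]. *)
Lemma polygon_step rho f f' K M r s :
  (3 <= M)%nat -> smooth_with rho f f' K -> 0 <= r <= rho -> 0 <= s <= rho ->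
  Cmod (csum (fun j => f (RtoC s * root M j)%C) M
        - csum (fun j => f (RtoC r * root M j)%C) M)
  <= INR M * (K * (rho * Cmod (root M 1 - 1) * Rabs (s - r) + (s - r) ^ 2)).
Proof.
  intros HM Hf Hr Hs.
  set (om := root M 1). set (d := Cmod (om - 1)).
  assert (HM0 : (0 < M)%nat) by lia.
  assert (Cr : forall t j, 0 <= t -> Cmod (RtoC t * root M j) = t).
  { intros t j Ht. rewrite Cmod_mult, Cmod_root, Cmod_R, Rabs_pos_eq; lra. }
  assert (Hd : 0 < d).
  { apply Cmod_gt_0. intros E. apply (root_1_neq M HM).
    apply Cminus_eq_0. exact E. }
  assert (PK : 0 <= K).
  { destruct (Hf (RtoC r * root M 0)%C (RtoC r * root M 0)%C) as (P & _ & _);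
      try (rewrite Cr; lra).
    eapply Rle_trans; [apply Cmod_ge_0|exact P]. }
  set (T := csum (fun j => f' (RtoC r * root M j) * root M j)%C M).
  assert (HT : Cmod T <= INR M * (K * rho * d)).
  { assert (E0 : forall F : nat -> C, F M = F O ->
              csum (fun j => F (S j) - F j)%C M = RtoC 0).
    { intros F HF. rewrite csum_telescope, HF. ring. }
    assert (Eper : root M M = root M 0) by (now rewrite root_0, root_period).
    (* at the centre the increments vanish and give nothing; there [T] is
       [f' 0] times the sum of the roots of unity *)
    destruct (Req_dec r 0) as [Er|Er].
    - assert (E : ((om - 1) * T)%C = RtoC 0).
      { unfold T. rewrite <- csum_scal.
        rewrite (csum_ext _ (fun j => f' 0 * (root M (S j) - root M j))%C).
        - rewrite csum_scal, (E0 (root M) Eper). ring.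
        - intros j _. rewrite root_S by exact HM0. fold om. rewrite Er.
          replace (RtoC 0 * root M j)%C with (RtoC 0) by ring. ring. }
      assert (E' : d * Cmod T = 0).
      { unfold d. rewrite <- Cmod_mult, E. apply Cmod_0. }
      assert (Cmod T = 0) by (apply Rmult_integral in E'; lra).
      rewrite H. apply Rmult_le_pos; [apply pos_INR|].
      apply Rmult_le_pos; [apply Rmult_le_pos|]; lra.
    - assert (E : (RtoC r * (om - 1) * T)%C =
        (- csum (fun j => f (RtoC r * root M (S j)) - f (RtoC r * root M j)
             - f' (RtoC r * root M j) *
               (RtoC r * root M (S j) - RtoC r * root M j)) M)%C).
      { rewrite (csum_ext _ (fun j => (f (RtoC r * root M (S j)) - f (RtoC r * root M j))
           + - (RtoC r * (om - 1)) * (f' (RtoC r * root M j) * root M j))%C).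
        - rewrite csum_plus, csum_scal.
          rewrite (E0 (fun j => f (RtoC r * root M j))%C) by (now rewrite Eper).
          fold T. ring.
        - intros j _. rewrite (root_S M j) by exact HM0. fold om. ring. }
      apply (f_equal Cmod) in E. rewrite !Cmod_mult, Cmod_opp, Cmod_R in E.
      fold d in E. rewrite Rabs_pos_eq in E by lra.
      assert (B : r * d * Cmod T <= INR M * (K * (r * d) ^ 2)).
      { rewrite E. eapply Rle_trans; [apply Cmod_csum|].
        rewrite <- rsum_const. apply rsum_le. intros j _.
        eapply Rle_trans; [apply Hf; rewrite Cr; lra|].
        apply Rmult_le_compat_l; [exact PK|]. right. f_equal.
        rewrite root_S by exact HM0. fold om.
        replace (RtoC r * (om * root M j) - RtoC r * root M j)%C with
          (RtoC r * (om - 1) * root M j)%C by ring.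
        rewrite !Cmod_mult, Cmod_root, Cmod_R, Rabs_pos_eq by lra.
        unfold d. ring. }
      apply Rle_trans with (INR M * (K * r * d)).
      + apply (Rmult_le_reg_l (r * d)); [apply Rmult_lt_0_compat; lra|].
        eapply Rle_trans; [exact B|]. right. ring.
      + apply Rmult_le_compat_l; [apply pos_INR|].
        apply Rmult_le_compat_r; [lra|]. apply Rmult_le_compat_l; lra. }
  replace (csum (fun j => f (RtoC s * root M j)%C) M
        - csum (fun j => f (RtoC r * root M j)%C) M)%C with
    (csum (fun j => f (RtoC s * root M j) - f (RtoC r * root M j)
       - f' (RtoC r * root M j) * (RtoC s * root M j - RtoC r * root M j)) M
     + RtoC (s - r) * T)%C.
  2:{ unfold T. rewrite <- csum_scal, <- csum_plus.
      rewrite (csum_ext _ (fun j => f (RtoC s * root M j)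
               + (- (1)) * f (RtoC r * root M j))%C).
      - rewrite csum_plus, csum_scal. ring.
      - intros j _. rewrite RtoC_minus. ring. }
  eapply Rle_trans; [apply Cmod_triangle|].
  rewrite Cmod_mult, Cmod_R.
  assert (B : Cmod (csum (fun j => f (RtoC s * root M j) - f (RtoC r * root M j)
       - f' (RtoC r * root M j) * (RtoC s * root M j - RtoC r * root M j)) M)%C
       <= INR M * (K * (s - r) ^ 2)).
  { eapply Rle_trans; [apply Cmod_csum|].
    rewrite <- rsum_const. apply rsum_le. intros j _.
    eapply Rle_trans; [apply Hf; rewrite Cr; lra|].
    apply Rmult_le_compat_l; [exact PK|]. right.
    replace (RtoC s * root M j - RtoC r * root M j)%C with
      (RtoC (s - r) * root M j)%C by (rewrite RtoC_minus; ring).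
    rewrite Cmod_mult, Cmod_root, Cmod_R, Rmult_1_r. apply pow2_abs. }
  assert (B' : Rabs (s - r) * Cmod T <= Rabs (s - r) * (INR M * (K * rho * d))).
  { apply Rmult_le_compat_l; [apply Rabs_pos|exact HT]. }
  eapply Rle_trans; [apply Rplus_le_compat; eassumption|]. right. ring.
Qed.

(** From the centre to radius [rho] in [M] equal steps: at the centre the sum
    is exactly [M * f 0], and the [M] quadratic errors, each of order
    [1 / M^2] per vertex, remain small. *)
Lemma polygon_mean_bound rho f f' K M :
  (3 <= M)%nat -> 0 <= rho -> smooth_with rho f f' K ->
  Cmod (csum (fun j => f (RtoC rho * root M j)%C) M - RtoC (INR M) * f 0)
  <= INR M * (K * rho ^ 2 * (Cmod (root M 1 - 1) + / INR M)).
Proof.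
  intros HM Hrho Hf. set (d := Cmod (root M 1 - 1)).
  assert (PM : 0 < INR M) by (apply lt_0_INR; lia).
  assert (H : forall i, (i <= M)%nat ->
    Cmod (csum (fun j => f (RtoC (rho * INR i / INR M) * root M j)%C) M
          - RtoC (INR M) * f 0)
    <= INR i * (K * rho ^ 2 * (d + / INR M))).
  { induction i as [|i IH]; intros Hi.
    - rewrite (csum_ext _ (fun _ => f 0)).
      + rewrite csum_const.
        replace (RtoC (INR M) * f 0 - RtoC (INR M) * f 0)%C with (RtoC 0) by ring.
        rewrite Cmod_0. simpl. lra.
      + intros j _. f_equal. simpl (INR 0).
        replace (rho * 0 / INR M) with 0 by (unfold Rdiv; ring). ring.
    - assert (PI' : INR i + 1 <= INR M) by (rewrite <- S_INR; now apply le_INR).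
      assert (Pi := pos_INR i).
      assert (Rg : forall x, 0 <= x <= INR M -> 0 <= rho * x / INR M <= rho).
      { intros x Hx. split.
        - apply Rdiv_le_0_compat; [apply Rmult_le_pos; lra|lra].
        - apply (Rmult_le_reg_r (INR M)); [lra|]. unfold Rdiv.
          rewrite Rmult_assoc, Rinv_l, Rmult_1_r by lra.
          apply Rmult_le_compat_l; lra. }
      assert (St := polygon_step rho f f' K M (rho * INR i / INR M)
         (rho * INR (S i) / INR M) HM Hf (Rg (INR i) ltac:(lra))
         (Rg (INR (S i)) ltac:(rewrite S_INR; lra))).
      fold d in St.
      replace (rho * INR (S i) / INR M - rho * INR i / INR M) with (rho / INR M) in St
        by (rewrite (S_INR i); field; lra).
      rewrite Rabs_pos_eq in St by (apply Rdiv_le_0_compat; lra).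
      eapply Rle_trans; [apply Cmod_minus_triangle|].
      eapply Rle_trans; [apply Rplus_le_compat; [exact St|apply IH; lia]|].
      rewrite S_INR. right. field. lra. }
  specialize (H M (le_n M)).
  replace (rho * INR M / INR M) with rho in H by (field; lra). exact H.
Qed.

(** The mean value property of holomorphic functions. *)
Lemma circle_mean_smooth rho f :
  0 <= rho -> smooth rho f -> circle_mean rho (fun z => Re (f z)) (Re (f 0)).
Proof.
  intros Hrho (f' & K & Hf). unfold circle_mean.
  set (E := fun M => K * rho ^ 2 * (Cmod (root M 1 - 1) + / INR M)).
  assert (LE : is_lim_seq E 0).
  { replace (Finite 0) with (Rbar_mult (K * rho ^ 2) (0 + 0))
      by (simpl; f_equal; ring).
    apply is_lim_seq_scal_l. apply is_lim_seq_plus';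
      [apply root_1_lim|apply is_lim_seq_inv_INR]. }
  assert (B : forall M, (3 <= M)%nat ->
     Rabs (rsum (fun j => Re (f (RtoC rho * root M j)%C)) M / INR M - Re (f 0)) <= E M).
  { intros M HM. assert (PM : 0 < INR M) by (apply lt_0_INR; lia).
    rewrite <- Re_csum.
    assert (H := polygon_mean_bound rho f f' K M HM Hrho Hf).
    assert (H' := Rle_trans _ _ _ (re_le_Cmod _) H).
    unfold Cminus in H'; rewrite re_plus, re_opp, re_scal_l in H'.
    apply (Rmult_le_reg_l (INR M)); [exact PM|].
    rewrite <- (Rabs_pos_eq (INR M)) at 1 by lra. rewrite <- Rabs_mult.
    replace (INR M * (Re (csum (fun j => f (RtoC rho * root M j)%C) M) / INR M
        - Re (f 0))) with (Re (csum (fun j => f (RtoC rho * root M j)%C) M)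
        - INR M * Re (f 0)) by (field; lra).
    exact H'. }
  apply is_lim_seq_le_le_loc with
    (fun M => Re (f 0) - E M) (fun M => Re (f 0) + E M).
  - exists 3%nat. intros M HM. specialize (B M HM).
    apply Rabs_le_between in B. lra.
  - replace (Re (f 0)) with (Re (f 0) - 0) at 1 by ring.
    apply is_lim_seq_minus'; [apply is_lim_seq_const|exact LE].
  - replace (Re (f 0)) with (Re (f 0) + 0) at 1 by ring.
    apply is_lim_seq_plus'; [apply is_lim_seq_const|exact LE].
Qed.

Lemma circle_mean_ext rho u v l :
  0 <= rho -> (forall z, Cmod z = rho -> u z = v z) ->
  circle_mean rho u l -> circle_mean rho v l.
Proof.
  intros Hr H. apply is_lim_seq_ext. intros M. f_equal.
  apply rsum_ext. intros j _. apply H.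
  rewrite Cmod_mult, Cmod_root, Cmod_R, Rabs_pos_eq; lra.
Qed.

Lemma circle_mean_plus rho u v l m :
  circle_mean rho u l -> circle_mean rho v m ->
  circle_mean rho (fun z => u z + v z) (l + m).
Proof.
  intros H H'. unfold circle_mean.
  eapply is_lim_seq_ext; [|apply is_lim_seq_plus'; [exact H|exact H']].
  intros M. simpl. rewrite rsum_plus. unfold Rdiv. ring.
Qed.

Lemma circle_mean_scal rho c u l :
  circle_mean rho u l -> circle_mean rho (fun z => c * u z) (c * l).
Proof.
  intros H. unfold circle_mean.
  eapply is_lim_seq_ext; [|exact (is_lim_seq_scal_l _ c (Finite l) H)].
  intros M. simpl. rewrite rsum_scal. unfold Rdiv. ring.
Qed.

Lemma circle_mean_const rho c : 0 <= rho -> circle_mean rho (fun _ => c) c.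
Proof.
  intros Hr. apply (circle_mean_smooth rho (fun _ => RtoC c) Hr).
  apply smooth_const.
Qed.

Lemma circle_mean_le rho u v l m :
  0 <= rho -> (forall z, Cmod z = rho -> u z <= v z) ->
  circle_mean rho u l -> circle_mean rho v m -> l <= m.
Proof.
  intros Hr H Hu Hv.
  apply (is_lim_seq_le_loc _ _ l m) with (2 := Hu) (3 := Hv).
  exists 1%nat. intros M HM. apply Rmult_le_compat_r.
  - apply Rlt_le, Rinv_0_lt_compat, lt_0_INR. lia.
  - apply rsum_le. intros j _. apply H.
    rewrite Cmod_mult, Cmod_root, Cmod_R, Rabs_pos_eq; lra.
Qed.

(** * Coefficient estimates from circle averages *)

Lemma Cmod2_plus x y :
  Cmod (x + y) ^ 2 = Cmod x ^ 2 + 2 * Re (Cconj x * y) + Cmod y ^ 2.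
Proof.
  rewrite !Cmod2_alt, re_mult, re_conj, im_conj, re_plus, im_plus. ring.
Qed.

Lemma Cconj_mult_same z : (Cconj z * z)%C = RtoC (Cmod z ^ 2).
Proof. rewrite Cmod2_conj. ring. Qed.

Lemma Cconj_R (x : R) : Cconj x = x.
Proof. unfold Cconj, RtoC. simpl. f_equal. ring. Qed.

Lemma circle_mean_pow rho c n :
  0 <= rho -> circle_mean rho (fun z => Re (c * z ^ S n)) 0.
Proof.
  intros Hr.
  assert (H := circle_mean_smooth rho _ Hr
    (smooth_scal rho c _ (smooth_pow rho (S n)))).
  cbv beta in H.
  replace (Re (c * 0 ^ S n)) with 0 in H; [exact H|].
  rewrite Cpow_S. replace (c * (0 * 0 ^ n))%C with (RtoC 0) by ring.
  reflexivity.
Qed.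

(** On the circle [conj z * z = rho^2], so [conj (z^n)] isolates the [n]-th
    coefficient: lower ones leave a power of [conj z], whose mean is zero,
    and the rest is an analytic function with value [c n] at the centre. *)
Lemma circle_mean_coef rho lam c n :
  0 <= rho < 1 -> subgeometric c ->
  circle_mean rho (fun z => Re (Cconj (z ^ n) * (lam * ev c z)))
    (rho ^ (2 * n) * Re (lam * c n)).
Proof.
  intros Hr. revert c. induction n as [|n IH]; intros c Hc.
  - assert (H := circle_mean_smooth rho _ (proj1 Hr)
      (smooth_scal rho lam _ (smooth_ev rho c (proj2 Hr) Hc))).
    cbv beta in H. rewrite ev_0 in H by exact Hc.
    change (rho ^ (2 * 0)) with 1. rewrite Rmult_1_l.
    eapply circle_mean_ext; [| |exact H]; [lra|].
    intros z _. change (z ^ 0)%C with (RtoC 1). rewrite Cconj_R. f_equal. ring.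
  - apply circle_mean_ext with (fun z =>
      Re (Cconj (lam * c O) * z ^ S n)
      + rho ^ 2 * Re (Cconj (z ^ n) * (lam * ev (shift c) z))); [lra| |].
    + intros z Hz. rewrite (ev_shift c z) by (auto; lra).
      rewrite <- (re_conj (Cconj (lam * c O) * z ^ S n)).
      rewrite Cmult_conj, Cconj_conj, <- re_scal_l, <- re_plus.
      f_equal. rewrite Cpow_S, Cmult_conj.
      replace (Cconj z * Cconj (z ^ n) * (lam * (c O + z * ev (shift c) z)))%C
        with (lam * c O * (Cconj z * Cconj (z ^ n))
              + (Cconj z * z) * (Cconj (z ^ n) * (lam * ev (shift c) z)))%C by ring.
      rewrite Cconj_mult_same, Hz. reflexivity.
    + replace (rho ^ (2 * S n) * Re (lam * c (S n))) with
        (0 + rho ^ 2 * (rho ^ (2 * n) * Re (lam * shift c n))).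
      * apply circle_mean_plus; [apply circle_mean_pow; lra|].
        apply circle_mean_scal, IH. now apply subgeometric_shift.
      * unfold shift. replace (2 * S n)%nat with (2 + 2 * n)%nat by lia.
        rewrite pow_add. ring.
Qed.

Lemma le_at_1 (f : R -> R) B :
  continuity_pt f 1 -> (forall r, 0 < r < 1 -> f r <= B) -> f 1 <= B.
Proof.
  intros Hf HB. apply Rnot_lt_le. intros Hlt.
  destruct (Hf (f 1 - B)) as (d & Hd & H); [lra|].
  set (r := Rmax (1 / 2) (1 - d / 2)).
  assert (Hr : 1 / 2 <= r < 1 /\ 1 - d / 2 <= r).
  { unfold r. split; [split|].
    - apply Rmax_l.
    - apply Rmax_lub_lt; lra.
    - apply Rmax_r. }
  specialize (HB r ltac:(lra)).
  assert (H' : R_dist (f r) (f 1) < f 1 - B).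
  { apply H. split.
    - split; [exact I|lra].
    - unfold Rdist; simpl; unfold Rdist. apply Rabs_def1; lra. }
  unfold R_dist in H'. apply Rabs_def2 in H'. lra.
Qed.

(** Carathéodory's inequality: [1 - Re h] is a nonnegative function, and so is
    its product with [1 + Re (lam z^n) / rho^n]; the mean of this product over
    a circle is a combination of [a 0] and [a n] alone. *)
Lemma caratheodory a n :
  subgeometric a -> (forall z, Cmod z < 1 -> Re (ev a z) <= 1) ->
  Cmod (a (S n)) <= 2 * (1 - Re (a O)).
Proof.
  intros Ha Hre.
  assert (H0 : Re (a O) <= 1).
  { rewrite <- (ev_0 a Ha). apply Hre, Cmod0_lt_1. }
  destruct (Ceq_dec (a (S n)) 0) as [E|E].
  { rewrite E, Cmod_0. lra. }
  assert (P : 0 < Cmod (a (S n))) by now apply Cmod_gt_0.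
  (* the phase for which the mean involves [Cmod (a (S n))] itself *)
  set (lam := (a (S n) * RtoC (/ Cmod (a (S n))))%C).
  assert (Hlam : Cmod lam = 1).
  { unfold lam. rewrite Cmod_mult, Cmod_R, Rabs_pos_eq.
    - field. lra.
    - apply Rlt_le, Rinv_0_lt_compat, P. }
  assert (Hlam' : Re (Cconj lam * a (S n)) = Cmod (a (S n))).
  { unfold lam. rewrite Cmult_conj.
    rewrite Cconj_R.
    replace (Cconj (a (S n)) * RtoC (/ Cmod (a (S n))) * a (S n))%C with
      (RtoC (/ Cmod (a (S n))) * (Cconj (a (S n)) * a (S n)))%C by ring.
    rewrite Cconj_mult_same, re_scal_l, re_RtoC. field. lra. }
  replace (Cmod (a (S n))) with (Cmod (a (S n)) * 1 ^ S n)
    by (rewrite pow1; ring).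
  apply (le_at_1 (fun r => Cmod (a (S n)) * r ^ S n)).
  { apply derivable_continuous_pt.
    apply derivable_pt_scal. apply derivable_pt_pow. }
  intros r Hr. set (q := / (2 * r ^ S n)).
  assert (Pr : 0 < r ^ S n) by (apply pow_lt; lra).
  assert (Pq : 0 < q) by (apply Rinv_0_lt_compat; lra).
  assert (M := circle_mean_plus r _ _ _ _
     (circle_mean_plus r _ _ _ _
       (circle_mean_plus r _ _ _ _
         (circle_mean_const r 1 ltac:(lra))
         (circle_mean_scal r (-1) _ _
           (circle_mean_smooth r _ ltac:(lra) (smooth_ev r a (proj2 Hr) Ha))))
       (circle_mean_scal r (2 * q) _ _
         (circle_mean_pow r lam n ltac:(lra))))
     (circle_mean_scal r (- q) _ _
       (circle_mean_plus r _ _ _ _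
         (circle_mean_coef r (Cconj lam) a (S n) ltac:(lra) Ha)
         (circle_mean_smooth r _ ltac:(lra)
           (smooth_mult r _ _ (smooth_scal r lam _ (smooth_pow r (S n)))
              (smooth_ev r a (proj2 Hr) Ha)))))).
  cbv beta in M. rewrite Hlam', ev_0 in M by exact Ha.
  rewrite Cpow_S in M at 1.
  replace (lam * (0 * 0 ^ n) * a O)%C with (RtoC 0) in M by ring.
  assert (L := fun H => circle_mean_le r (fun _ => 0) _ 0 _ ltac:(lra) H
     (circle_mean_const r 0 ltac:(lra)) M).
  clear M. cbv beta in L.
  match type of L with ?A -> _ => assert (HA : A); [|assert (M := L HA)] end.
  2: { replace (2 * S n)%nat with (S n + S n)%nat in M by lia.
    rewrite pow_add in M. change (Re (RtoC 0)) with 0 in M.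
    assert (E1 : q * (r ^ S n * r ^ S n * Cmod (a (S n)))
              = Cmod (a (S n)) * r ^ S n / 2) by (unfold q; field; lra).
    lra. }
  - intros z Hz. specialize (Hre z ltac:(lra)).
    set (h := ev a z) in *. set (y := (lam * z ^ S n)%C).
    assert (Hy : Rabs (Re y) <= r ^ S n).
    { eapply Rle_trans; [apply re_le_Cmod|]. unfold y.
      rewrite Cmod_mult, Hlam, Cmod_pow, Hz. lra. }
    apply Rabs_le_between in Hy.
    replace (Cconj (z ^ S n) * (Cconj lam * h))%C with (Cconj y * h)%C
      by (unfold y; rewrite Cmult_conj; ring).
    assert (E2 : Re (Cconj y * h) + Re (y * h) = 2 * Re y * Re h).
    { rewrite !re_mult, re_conj, im_conj. ring. }
    rewrite E2.
    replace (1 + -1 * Re h + 2 * q * Re y + - q * (2 * Re y * Re h)) with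
      ((1 - Re h) * (1 + 2 * q * Re y)) by ring.
    apply Rmult_le_pos; [lra|].
    assert (2 * q * r ^ S n = 1) by (unfold q; field; lra).
    nra.
Qed.

Lemma smooth_partial rho c N : smooth rho (fun z => partial c z N).
Proof.
  induction N as [|N IH].
  - exact (smooth_const rho 0).
  - exact (smooth_plus rho _ _ IH (smooth_scal rho (c N) _ (smooth_pow rho N))).
Qed.

Lemma partial_shift c z N :
  partial c z (S N) = (c O + z * partial (shift c) z N)%C.
Proof.
  unfold partial. rewrite csum_first, <- csum_scal. f_equal.
  - simpl. ring.
  - apply csum_ext. intros i _. unfold shift. simpl. ring.
Qed.

(** By induction from [c_0 + z P]: the cross term is analytic and vanishes at
    the centre. *)
Lemma parseval rho c N :
  0 <= rho ->
  circle_mean rho (fun z => Cmod (partial c z N) ^ 2)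
    (rsum (fun i => Cmod (c i) ^ 2 * rho ^ (2 * i)) N).
Proof.
  intros Hr. revert c. induction N as [|N IH]; intros c.
  - apply circle_mean_ext with (fun _ => 0); [exact Hr| |].
    + intros z _. unfold partial. simpl csum. rewrite Cmod_0. ring.
    + now apply circle_mean_const.
  - rewrite rsum_first.
    apply circle_mean_ext with (fun z => Cmod (c O) ^ 2 +
       2 * Re (Cconj (c O) * (z * partial (shift c) z N))
       + rho ^ 2 * Cmod (partial (shift c) z N) ^ 2); [exact Hr| |].
    + intros z Hz. rewrite partial_shift, Cmod2_plus, Cmod_mult, Hz. ring.
    + apply circle_mean_plus.
      * replace (Cmod (c O) ^ 2 * rho ^ (2 * 0)) with (Cmod (c O) ^ 2 + 2 * 0)
          by (simpl; ring).
        apply circle_mean_plus; [now apply circle_mean_const|].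
        apply circle_mean_scal.
        assert (H := circle_mean_smooth rho _ Hr
          (smooth_scal rho (Cconj (c O)) _
            (smooth_mult rho _ _ (smooth_id rho) (smooth_partial rho (shift c) N)))).
        cbv beta in H.
        replace (Cconj (c O) * (0 * partial (shift c) 0 N))%C with (RtoC 0) in H
          by ring.
        exact H.
      * assert (H := circle_mean_scal rho (rho ^ 2) _ _ (IH (shift c))).
        rewrite <- rsum_scal in H.
        erewrite rsum_ext; [exact H|]. intros i _. unfold shift.
        replace (2 * S i)%nat with (2 + 2 * i)%nat by lia.
        rewrite pow_add. ring.
Qed.

Definition tail (N : nat) (c : nat -> C) (n : nat) : C := c (N + n)%nat.

Lemma subgeometric_tail N c : subgeometric c -> subgeometric (tail N c).
Proof.
  revert c. induction N as [|N IH]; intros c Hc.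
  - exact Hc.
  - exact (IH _ (subgeometric_shift c Hc)).
Qed.

Lemma ev_split N c z :
  subgeometric c -> Cmod z < 1 ->
  ev c z = (partial c z N + z ^ N * ev (tail N c) z)%C.
Proof.
  revert c. induction N as [|N IH]; intros c Hc Hz.
  - change (tail 0 c) with c. unfold partial. simpl. ring.
  - rewrite ev_shift, partial_shift by assumption.
    rewrite (IH (shift c)) by auto using subgeometric_shift.
    change (tail (S N) c) with (tail N (shift c)). simpl. ring.
Qed.

(** On the circle [conj z = rho^2 / z], so the conjugate of a polynomial of
    degree below [N] becomes analytic after multiplication by [z^N]. *)
Lemma conj_partial_smooth rho c N M :
  (M <= N)%nat ->
  exists E, smooth rho E /\ E 0 = RtoC 0 /\
    forall z, Cmod z = rho -> (Cconj (partial c z M) * z ^ N)%C = E z.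
Proof.
  intros HM. induction M as [|M IH].
  - exists (fun _ => RtoC 0). split; [apply smooth_const|]. split; [reflexivity|].
    intros z _. unfold partial. simpl csum.
    rewrite Cconj_R. ring.
  - destruct IH as (E & HE & HE0 & Heq); [lia|].
    exists (fun z => E z + Cconj (c M) * RtoC (rho ^ 2) ^ M * z ^ (N - M))%C.
    split; [|split].
    + apply smooth_plus; [exact HE|]. apply smooth_scal, smooth_pow.
    + rewrite HE0. replace (N - M)%nat with (S (N - S M)) by lia.
      rewrite Cpow_S. ring.
    + intros z Hz. rewrite <- Heq by exact Hz.
      change (partial c z (S M)) with (partial c z M + c M * z ^ M)%C.
      rewrite Cplus_conj, Cmult_conj, Cpow_conj.
      replace (z ^ N)%C with (z ^ M * z ^ (N - M))%C at 1
        by (rewrite <- Cpow_add_r; f_equal; lia).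
      replace (z ^ N)%C with (z ^ M * z ^ (N - M))%C
        by (rewrite <- Cpow_add_r; f_equal; lia).
      rewrite <- Hz, <- Cconj_mult_same, Cpow_mult_l. ring.
Qed.

(** Let [P] and [D] be the [N]-th partial sums of [ev h] and [ev g].  Since the
    terms of [ev h] of degree at least [N] do not influence the first [N]
    coefficients of [W * ev h], one has [W P = D + z^N V] with [V] analytic.
    The two summands are orthogonal on the circle, so the mean square of [D]
    is at most that of [W P], hence at most [k^2] times that of [P]. *)
Lemma section_contraction rho k W g h N :
  0 <= rho < 1 -> 0 <= k -> smooth rho W ->
  (forall z, Cmod z <= rho -> Cmod (W z) <= k) ->
  subgeometric g -> subgeometric h ->
  (forall z, Cmod z <= rho -> ev g z = (W z * ev h z)%C) ->
  rsum (fun i => Cmod (g i) ^ 2 * rho ^ (2 * i)) N <=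
  k ^ 2 * rsum (fun i => Cmod (h i) ^ 2 * rho ^ (2 * i)) N.
Proof.
  intros Hr Hk HW Hbound Hg Hh Heq.
  set (V := fun z => (ev (tail N g) z + (- (1)) * (W z * ev (tail N h) z))%C).
  assert (HV : smooth rho V).
  { apply smooth_plus; [|apply smooth_scal, smooth_mult; [exact HW|]];
      apply smooth_ev; try lra; now apply subgeometric_tail. }
  destruct (conj_partial_smooth rho g N N (le_n N)) as (E & HE & HE0 & HEq).
  assert (M := circle_mean_plus rho _ _ _ _ (parseval rho g N (proj1 Hr))
     (circle_mean_scal rho 2 _ _
       (circle_mean_smooth rho _ (proj1 Hr) (smooth_mult rho _ _ HE HV)))).
  assert (M' := circle_mean_scal rho (k ^ 2) _ _ (parseval rho h N (proj1 Hr))).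
  assert (L := fun H => circle_mean_le rho _ _ _ _ (proj1 Hr) H M M').
  cbv beta in L.
  rewrite HE0 in L. replace (0 * V 0)%C with (RtoC 0) in L by ring.
  rewrite re_RtoC, Rmult_0_r, Rplus_0_r in L. apply L. clear L M M'.
  intros z Hz. rewrite <- HEq by exact Hz.
  assert (Hz1 : Cmod z < 1) by lra.
  assert (EV : (W z * partial h z N = partial g z N + z ^ N * V z)%C).
  { assert (Q := Heq z ltac:(lra)).
    rewrite (ev_split N g), (ev_split N h) in Q by assumption.
    unfold V. apply Cminus_eq_0.
    replace (W z * partial h z N - (partial g z N + z ^ N *
       (ev (tail N g) z + - (1) * (W z * ev (tail N h) z))))%C with
      (W z * (partial h z N + z ^ N * ev (tail N h) z)
        - (partial g z N + z ^ N * ev (tail N g) z))%C by ring.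
    rewrite Q. ring. }
  assert (EM : Cmod (W z * partial h z N) ^ 2 <= k ^ 2 * Cmod (partial h z N) ^ 2).
  { rewrite Cmod_mult, Rpow_mult_distr. apply Rmult_le_compat_r; [apply pow2_ge_0|].
    apply pow_incr. split; [apply Cmod_ge_0|apply Hbound; lra]. }
  rewrite EV, Cmod2_plus in EM.
  assert (P := pow2_ge_0 (Cmod (z ^ N * V z))).
  replace (Cconj (partial g z N) * z ^ N * V z)%C with
    (Cconj (partial g z N) * (z ^ N * V z))%C by ring.
  lra.
Qed.

(** * Quotients of power series *)

(** Compactness of the disk, in the form of a finite cover of a square. *)
Lemma smooth_lower_bound rho f :
  smooth rho f -> (forall z, Cmod z <= rho -> f z <> 0) ->
  exists m, 0 < m /\ forall z, Cmod z <= rho -> m <= Cmod (f z).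
Proof.
  intros Hf Hnz. destruct (smooth_lipschitz rho f Hf) as (L & HL & Lip).
  (* In the disk, a radius within which the Lipschitz bound keeps [|f|] above
     half its value at [(u, v)]; outside, one too small to reach the disk. *)
  set (dl := fun u v => if Rle_dec (Cmod (u, v)) rho
                        then Cmod (f (u, v)) / (4 * L)
                        else (Cmod (u, v) - rho) / 2).
  assert (Hdl : forall u v, 0 < dl u v).
  { intros u v. unfold dl. destruct (Rle_dec (Cmod (u, v)) rho) as [H|H].
    - apply Rdiv_lt_0_compat; [|lra]. apply Cmod_gt_0. now apply Hnz.
    - lra. }
  destruct (compactness_value_2d (- rho) rho (- rho) rho
    (fun u v => mkposreal (dl u v) (Hdl u v))) as [d Hd].
  assert (Pd := cond_pos d).
  exists (2 * L * d). split; [repeat apply Rmult_lt_0_compat; lra|].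
  intros z Hz. apply Rnot_lt_le. intros Hlt.
  assert (Hx := re_le_Cmod z). assert (Hy := im_le_Cmod z).
  apply Rabs_le_between in Hx. apply Rabs_le_between in Hy.
  apply (Hd (Re z) (Im z)); [lra|lra|].
  intros (u & v & _ & _ & Hu & Hv & Hduv). simpl in Hu, Hv, Hduv.
  assert (Hdist : Cmod (z - (u, v)) < 2 * dl u v).
  { eapply Rle_lt_trans; [apply Cmod_le_Re_Im|].
    change (Re (z - (u, v))) with (Re z - u).
    change (Im (z - (u, v))) with (Im z - v). lra. }
  revert Hdist Hduv. unfold dl.
  destruct (Rle_dec (Cmod (u, v)) rho) as [H|H]; intros Hdist Hduv.
  - assert (Q := Lip z (u, v) Hz H).
    assert (Q' := Cmod_le_plus (f (u, v)) (f z)).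
    rewrite Cmod_minus_comm in Hdist.
    assert (L * Cmod ((u, v) - z) <= L * (2 * (Cmod (f (u, v)) / (4 * L)))).
    { apply Rmult_le_compat_l; lra. }
    replace (L * (2 * (Cmod (f (u, v)) / (4 * L)))) with (Cmod (f (u, v)) / 2)
      in H0 by (field; lra).
    assert (2 * L * d <= 2 * L * (Cmod (f (u, v)) / (4 * L))).
    { apply Rmult_le_compat_l; lra. }
    replace (2 * L * (Cmod (f (u, v)) / (4 * L))) with (Cmod (f (u, v)) / 2)
      in H1 by (field; lra).
    lra.
  - assert (Q := Cmod_le_plus (u, v) z). rewrite Cmod_minus_comm in Q. lra.
Qed.

Definition dominated (k : R) (g h : nat -> C) : Prop :=
  forall z, Cmod z < 1 -> Cmod (ev g z) <= k * Cmod (ev h z).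

Definition has_quotient (rho k : R) (g h : nat -> C) : Prop :=
  exists W, smooth rho W /\ (forall z, Cmod z <= rho -> Cmod (W z) <= k) /\
    forall z, Cmod z <= rho -> ev g z = (W z * ev h z)%C.

Lemma quotient_zero_free rho k g h :
  rho < 1 -> subgeometric g -> subgeometric h -> dominated k g h ->
  (forall z, Cmod z <= rho -> ev h z <> 0) -> has_quotient rho k g h.
Proof.
  intros Hr Hg Hh Hd Hnz.
  destruct (smooth_lower_bound rho (ev h)) as (m & Hm & Hlow); [|exact Hnz|].
  { now apply smooth_ev. }
  exists (fun z => ev g z * / ev h z)%C. split; [|split].
  - apply smooth_mult; [now apply smooth_ev|].
    apply smooth_inv with m; auto. now apply smooth_ev.
  - intros z Hz. assert (P := Hlow z Hz).
    rewrite Cmod_mult, Cmod_inv by now apply Hnz.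
    apply (Rmult_le_reg_r (Cmod (ev h z))); [lra|].
    rewrite Rmult_assoc, Rinv_l, Rmult_1_r by lra. apply Hd. lra.
  - intros z Hz. field. now apply Hnz.
Qed.

(** Continuity recovers the inequality at the one point where a common factor
    that was divided out vanishes. *)
Lemma dominated_punctured k g h zeta :
  0 <= k -> subgeometric g -> subgeometric h -> Cmod zeta < 1 ->
  (forall z, Cmod z < 1 -> z <> zeta -> Cmod (ev g z) <= k * Cmod (ev h z)) ->
  dominated k g h.
Proof.
  intros Hk Hg Hh Hz H z Hz1. destruct (Ceq_dec z zeta) as [->|Hne];
    [|now apply H].
  apply Rnot_lt_le. intros Hlt.
  set (eta := Cmod (ev g zeta) - k * Cmod (ev h zeta)).
  assert (Peta : 0 < eta) by (unfold eta; lra).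
  set (r := (1 + Cmod zeta) / 2).
  assert (Hr : r < 1) by (unfold r; lra).
  destruct (smooth_lipschitz r _ (smooth_ev r g Hr Hg)) as (L & HL & Lip).
  destruct (smooth_lipschitz r _ (smooth_ev r h Hr Hh)) as (L' & HL' & Lip').
  assert (PkL : 0 <= k * L') by (apply Rmult_le_pos; lra).
  set (t := Rmin ((1 - Cmod zeta) / 2) (eta / (2 * (L + k * L')))).
  assert (Ht : 0 < t /\ t <= (1 - Cmod zeta) / 2 /\ t <= eta / (2 * (L + k * L'))).
  { unfold t. split; [apply Rmin_glb_lt|split; [apply Rmin_l|apply Rmin_r]].
    - lra.
    - apply Rdiv_lt_0_compat; lra. }
  destruct Ht as (Ht0 & Ht1 & Ht2).
  assert (Et : (zeta + RtoC t - zeta)%C = RtoC t) by ring.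
  assert (Mt : Cmod (zeta + RtoC t - zeta) = t)
    by (rewrite Et, Cmod_R; apply Rabs_pos_eq; lra).
  assert (B : Cmod (zeta + RtoC t) <= r).
  { eapply Rle_trans; [apply Cmod_triangle|].
    rewrite Cmod_R, Rabs_pos_eq by lra. unfold r. lra. }
  assert (Bz : Cmod zeta <= r) by (unfold r; lra).
  assert (Q := H (zeta + RtoC t)%C ltac:(lra)).
  assert (Hne : (zeta + RtoC t)%C <> zeta).
  { intros E. assert (RtoC t = RtoC 0) by (rewrite <- Et, E; ring).
    apply RtoC_inj in H0. lra. }
  specialize (Q Hne).
  assert (Q1 := Cmod_le_plus (ev g zeta) (ev g (zeta + RtoC t)%C)).
  rewrite Cmod_minus_comm in Q1.
  assert (Q2 := Lip zeta (zeta + RtoC t)%C Bz B). rewrite Mt in Q2.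
  assert (Q3 := Cmod_le_plus (ev h (zeta + RtoC t)%C) (ev h zeta)).
  assert (Q4 := Lip' zeta (zeta + RtoC t)%C Bz B). rewrite Mt in Q4.
  assert (Q5 : k * Cmod (ev h (zeta + RtoC t)%C) <= k * (Cmod (ev h zeta) + L' * t)).
  { apply Rmult_le_compat_l; lra. }
  assert (Q6 : (L + k * L') * t <= eta / 2).
  { apply Rle_trans with ((L + k * L') * (eta / (2 * (L + k * L')))).
    - apply Rmult_le_compat_l; lra.
    - right. field. lra. }
  unfold eta in *. lra.
Qed.

Lemma rsum_geom_le q n : 0 <= q < 1 -> rsum (fun i => q ^ i) n <= / (1 - q).
Proof.
  intros Hq. assert (Aq : Rabs q < 1) by (rewrite Rabs_pos_eq; lra).
  rewrite <- (is_series_unique _ _ (is_series_geom q Aq)).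
  apply Series_ge_rsum.
  - intros i. apply pow_le. lra.
  - now apply ex_series_geom.
Qed.

(** Synthetic division by [z - zeta]: the coefficients of the quotient are the
    values at [zeta] of the tails of the series. *)
Lemma divide_root c zeta :
  subgeometric c -> Cmod zeta < 1 -> ev c zeta = 0 ->
  exists d, subgeometric d /\ forall n, c n = (mul_by_z d n - zeta * d n)%C.
Proof.
  intros Hc Hz H0. exists (fun n => ev (tail (S n) c) zeta). split.
  - intros t Ht. set (x := Cmod zeta) in *.
    assert (Px : 0 <= x) by apply Cmod_ge_0.
    (* a radius above both [t] and [|zeta|], so that the powers of [zeta / s]
       are summable *)
    set (s := Rmax t ((1 + x) / 2)).
    assert (Hs : t <= s /\ (1 + x) / 2 <= s /\ s < 1).
    { unfold s. split; [apply Rmax_l|split; [apply Rmax_r|]].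
      apply Rmax_lub_lt; lra. }
    destruct Hs as (Hs1 & Hs2 & Hs3).
    assert (Hs0 : 0 < s) by lra.
    destruct (Hc s ltac:(lra)) as [B HB].
    assert (PB : 0 <= B).
    { eapply Rle_trans; [|apply (HB O)]. apply Rmult_le_pos; [apply Cmod_ge_0|].
      apply pow_le; lra. }
    set (q := x / s).
    assert (Hq : 0 <= q < 1).
    { unfold q. split; [apply Rdiv_le_0_compat; lra|].
      apply (Rmult_lt_reg_r s); [lra|]. unfold Rdiv.
      rewrite Rmult_assoc, Rinv_l by lra. lra. }
    exists (B / s * / (1 - q)). intros n.
    assert (Ps : 0 < s ^ n) by (apply pow_lt; lra).
    apply Rle_trans with (Cmod (ev (tail (S n) c) zeta) * s ^ n).
    { apply Rmult_le_compat_l; [apply Cmod_ge_0|]. apply pow_incr. lra. }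
    apply Rle_trans with (B / s * / (1 - q) / s ^ n * s ^ n).
    2:{ right. field. lra. }
    apply Rmult_le_compat_r; [lra|].
    apply (clim_bound (partial (tail (S n) c) zeta)).
    + apply ev_correct; [now apply subgeometric_tail|exact Hz].
    + intros N. eapply Rle_trans; [apply Cmod_csum|].
      apply Rle_trans with (B / s / s ^ n * rsum (fun i => q ^ i) N).
      * rewrite <- rsum_scal. apply rsum_le. intros i _.
        rewrite Cmod_mult, Cmod_pow. fold x. unfold tail.
        assert (Psi : 0 < s ^ i) by (apply pow_lt; lra).
        specialize (HB (S n + i)%nat).
        rewrite pow_add in HB. change (s ^ S n) with (s * s ^ n) in HB.
        replace (x ^ i) with (q ^ i * s ^ i).
        2:{ rewrite <- Rpow_mult_distr. f_equal. unfold q. field. lra. }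
        assert (Pqi : 0 <= q ^ i) by (apply pow_le; lra).
        replace (Cmod (c (S n + i)%nat) * (q ^ i * s ^ i)) with
          (Cmod (c (S n + i)%nat) * (s * s ^ n * s ^ i) / s / s ^ n * q ^ i)
          by (field; lra).
        apply Rmult_le_compat_r; [exact Pqi|].
        unfold Rdiv.
        apply Rmult_le_compat_r; [apply Rlt_le, Rinv_0_lt_compat, Ps|].
        apply Rmult_le_compat_r; [apply Rlt_le, Rinv_0_lt_compat, Hs0|].
        exact HB.
      * replace (B / s * / (1 - q) / s ^ n) with (B / s / s ^ n * / (1 - q))
          by (field; lra).
        apply Rmult_le_compat_l; [|now apply rsum_geom_le].
        apply Rdiv_le_0_compat; [apply Rdiv_le_0_compat|]; lra.
  - intros [|n]; cbv beta; simpl mul_by_z.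
    + assert (E := ev_shift c zeta Hc Hz). rewrite H0 in E.
      change (tail 1 c) with (shift c).
      replace (c O) with ((c O + zeta * ev (shift c) zeta)
                          - zeta * ev (shift c) zeta)%C by ring.
      rewrite <- E. ring.
    + rewrite (ev_shift (tail (S n) c)) by (auto using subgeometric_tail).
      replace (shift (tail (S n) c)) with (tail (S (S n)) c).
      * unfold tail at 1. replace (S n + 0)%nat with (S n) by lia. ring.
      * unfold shift, tail. apply functional_extensionality.
        intros i. f_equal. lia.
Qed.

(** Partial sums of the squared norm on the circle of radius [s]. *)
Definition sqnorm (s : R) (c : nat -> C) (N : nat) : R :=
  rsum (fun i => Cmod (c i) ^ 2 * s ^ (2 * i)) N.

(** Coefficients of [(s - conj zeta / s * z) * d(z)]. *)
Definition reflected (s : R) (zeta : C) (d : nat -> C) (n : nat) : C :=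
  (RtoC s * d n + - (Cconj zeta * RtoC (/ s)) * mul_by_z d n)%C.

Lemma subgeometric_reflected s zeta d :
  subgeometric d -> subgeometric (reflected s zeta d).
Proof.
  intros Hd. apply subgeometric_plus; apply subgeometric_scal;
    [exact Hd|now apply subgeometric_mul_by_z].
Qed.

Lemma ev_reflected s zeta d z :
  subgeometric d -> Cmod z < 1 ->
  ev (reflected s zeta d) z =
  ((RtoC s - Cconj zeta * RtoC (/ s) * z) * ev d z)%C.
Proof.
  intros Hd Hz. unfold reflected. rewrite ev_plus, !ev_scal, ev_mul_by_z;
    auto using subgeometric_scal, subgeometric_mul_by_z. ring.
Qed.

Lemma ev_linear_factor zeta c d z :
  subgeometric d -> Cmod z < 1 ->
  (forall n, c n = (mul_by_z d n - zeta * d n)%C) ->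
  ev c z = ((z - zeta) * ev d z)%C.
Proof.
  intros Hd Hz E.
  rewrite (functional_extensionality c (fun n => mul_by_z d n + - zeta * d n)%C).
  - rewrite ev_plus, ev_scal, ev_mul_by_z;
      auto using subgeometric_scal, subgeometric_mul_by_z. ring.
  - intros n. rewrite E. ring.
Qed.

(** The factor [(s^2 - conj zeta z) / (s (z - zeta))] has modulus one on the
    circle of radius [s], so the two products have the same norm there; on
    sections of length [N] they differ by a boundary term. *)
Lemma sqnorm_reflected s zeta c d N :
  0 < s -> (forall n, c n = (mul_by_z d n - zeta * d n)%C) ->
  sqnorm s (reflected s zeta d) (S N) =
  sqnorm s c (S N) + (s ^ 2 - Cmod zeta ^ 2) * (Cmod (d N) ^ 2 * s ^ (2 * N)).
Proof.
  intros Hs E. unfold sqnorm.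
  assert (K : forall x y, Cmod (RtoC s * x + - (Cconj zeta * RtoC (/ s)) * y) ^ 2
     = Cmod (y - zeta * x) ^ 2 + (s ^ 2 - Cmod zeta ^ 2) * Cmod x ^ 2
       - (s ^ 2 - Cmod zeta ^ 2) * (Cmod y ^ 2 / s ^ 2)).
  { intros x y. unfold Cminus. rewrite !Cmod2_plus, !Cmod_opp, !Cmod_mult.
    rewrite !Cmod_opp, !Cmod_mult, Cmod_conj, !Cmod_R.
    rewrite !Rabs_pos_eq by (try apply Rlt_le, Rinv_0_lt_compat; lra).
    replace (Cconj (RtoC s * x) * (- (Cconj zeta * RtoC (/ s)) * y))%C with
      (- Cconj (Cconj y * (zeta * x)))%C.
    - replace (Cconj y * - (zeta * x))%C with (- (Cconj y * (zeta * x)))%C by ring.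
      rewrite !re_opp, re_conj. field. lra.
    - rewrite !Cmult_conj, Cconj_conj, Cconj_R.
      assert (Es : (RtoC s * RtoC (/ s))%C = RtoC 1).
      { rewrite <- RtoC_mult. f_equal. field. lra. }
      transitivity ((RtoC s * RtoC (/ s)) * - (y * (Cconj zeta * Cconj x)))%C;
        [rewrite Es|]; ring. }
  induction N as [|N IH].
  - cbn [rsum]. rewrite E. unfold reflected. rewrite K. cbn [mul_by_z].
    rewrite Cmod_0. simpl. unfold Rdiv. ring.
  - change (rsum (fun i => Cmod (reflected s zeta d i) ^ 2 * s ^ (2 * i)) (S (S N)))
      with (rsum (fun i => Cmod (reflected s zeta d i) ^ 2 * s ^ (2 * i)) (S N)
        + Cmod (reflected s zeta d (S N)) ^ 2 * s ^ (2 * S N)).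
    change (rsum (fun i => Cmod (c i) ^ 2 * s ^ (2 * i)) (S (S N)))
      with (rsum (fun i => Cmod (c i) ^ 2 * s ^ (2 * i)) (S N)
        + Cmod (c (S N)) ^ 2 * s ^ (2 * S N)).
    rewrite IH, E. unfold reflected at 1. rewrite K. cbn [mul_by_z].
    replace (2 * S N)%nat with (2 + 2 * N)%nat by lia. rewrite pow_add.
    field. lra.
Qed.

Lemma sqnorm_mono s c N M : (N <= M)%nat -> sqnorm s c N <= sqnorm s c M.
Proof.
  intros H. apply rsum_mono; [|exact H]. intros i.
  apply Rmult_le_pos; [apply pow2_ge_0|]. rewrite pow_mult.
  apply pow_le, pow2_ge_0.
Qed.

(** The boundary term of the previous identity tends to zero. *)
Lemma sqnorm_reflected_le s zeta c d B :
  0 < s < 1 -> subgeometric d ->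
  (forall n, c n = (mul_by_z d n - zeta * d n)%C) ->
  (forall N, sqnorm s c N <= B) -> forall N, sqnorm s (reflected s zeta d) N <= B.
Proof.
  intros Hs Hd E HB N.
  assert (L : is_lim_seq (fun M => Cmod (d M) ^ 2 * s ^ (2 * M)) 0).
  { assert (L1 := ex_series_lim_0 _ (subgeometric_ex_series d s Hd ltac:(lra))).
    assert (L2 := is_lim_seq_mult' _ _ _ _ L1 L1). rewrite Rmult_0_l in L2.
    eapply is_lim_seq_ext; [|exact L2]. intros M. simpl.
    replace (M + (M + 0))%nat with (M + M)%nat by lia. rewrite pow_add. ring. }
  assert (L' : is_lim_seq (fun M => B + (s ^ 2 - Cmod zeta ^ 2) *
                               (Cmod (d M) ^ 2 * s ^ (2 * M))) B).
  { replace (Finite B) with (Finite (B + (s ^ 2 - Cmod zeta ^ 2) * 0))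
      by (f_equal; ring).
    apply is_lim_seq_plus'; [apply is_lim_seq_const|].
    exact (is_lim_seq_scal_l _ (s ^ 2 - Cmod zeta ^ 2) (Finite 0) L). }
  apply (is_lim_seq_le_loc (fun _ => sqnorm s (reflected s zeta d) N))
    with (3 := L') (l1 := sqnorm s (reflected s zeta d) N);
    [|apply is_lim_seq_const].
  exists N. intros M HM.
  apply Rle_trans with (sqnorm s (reflected s zeta d) (S M)).
  - apply sqnorm_mono. lia.
  - rewrite (sqnorm_reflected s zeta c d M) by (auto; lra).
    apply Rplus_le_compat_r, HB.
Qed.

Lemma sqnorm_bounded s c :
  0 <= s < 1 -> subgeometric c -> exists B, forall N, sqnorm s c N <= B.
Proof.
  intros Hs Hc. destruct (subgeometric_sum_bound c s Hc Hs) as (B & PB & HB).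
  assert (P : forall i, 0 <= Cmod (c i) * s ^ i).
  { intros i. apply Rmult_le_pos; [apply Cmod_ge_0|apply pow_le; lra]. }
  exists (B * B). intros N.
  apply Rle_trans with (B * rsum (fun i => Cmod (c i) * s ^ i) N).
  - rewrite <- rsum_scal. apply rsum_le. intros i _.
    replace (Cmod (c i) ^ 2 * s ^ (2 * i)) with
      ((Cmod (c i) * s ^ i) * (Cmod (c i) * s ^ i)).
    + apply Rmult_le_compat_r; [apply P|].
      eapply Rle_trans; [|apply (HB (S i))]. simpl.
      assert (Q := rsum_nonneg (fun i => Cmod (c i) * s ^ i) i (fun j _ => P j)).
      lra.
    + replace (2 * i)%nat with (i + i)%nat by lia. rewrite pow_add. ring.
  - apply Rmult_le_compat_l; [exact PB|apply HB].
Qed.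

(** Zeros of [h] in the disk of radius [rho] are removed one at a time.  Each
    removal replaces a factor [z - zeta] by its reflection in the circle of
    radius [s]: the norm of [h] on that circle does not grow, while [|h(0)|]
    is multiplied by at least [s / rho].  Since the norm bounds [|h(0)|], there
    are at most [n] removals. *)
Lemma quotient_by_removal rho s k n :
  0 < rho < s -> s < 1 -> 0 <= k -> forall g h B,
  subgeometric g -> subgeometric h -> dominated k g h ->
  (forall N, sqnorm s h N <= B) ->
  B < Cmod (h O) ^ 2 * (s / rho) ^ (2 * n) -> has_quotient rho k g h.
Proof.
  intros Hrs Hs Hk. induction n as [|n IH]; intros g h B Hg Hh Hd HB Hlt.
  - exfalso. specialize (HB 1%nat). unfold sqnorm in HB. simpl in HB, Hlt. lra.
  - destruct (classic (exists zeta, Cmod zeta <= rho /\ ev h zeta = 0))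
      as [(zeta & Hz & H0)|Hno].
    2:{ apply quotient_zero_free; auto; [lra|].
        intros z Hz E. apply Hno. now exists z. }
    assert (Hz1 : Cmod zeta < 1) by lra.
    assert (G0 : ev g zeta = 0).
    { apply Cmod_eq_0. apply Rle_antisym; [|apply Cmod_ge_0].
      eapply Rle_trans; [apply Hd, Hz1|]. rewrite H0, Cmod_0. lra. }
    destruct (divide_root h zeta Hh Hz1 H0) as (dh & Hdh & Eh).
    destruct (divide_root g zeta Hg Hz1 G0) as (dg & Hdg & Eg).
    assert (Fh := fun z Hz' => ev_linear_factor zeta h dh z Hdh Hz' Eh).
    assert (Fg := fun z Hz' => ev_linear_factor zeta g dg z Hdg Hz' Eg).
    assert (Dd : dominated k dg dh).
    { apply dominated_punctured with zeta; auto.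
      intros z Hz' Hne. assert (Q := Hd z Hz').
      rewrite Fg, Fh, !Cmod_mult in Q by assumption.
      assert (P : 0 < Cmod (z - zeta)).
      { apply Cmod_gt_0. intros E. apply Hne. now apply Cminus_eq_0. }
      apply (Rmult_le_reg_l (Cmod (z - zeta))); [exact P|]. lra. }
    destruct (IH (reflected s zeta dg) (reflected s zeta dh) B) as (W & W1 & W2 & W3).
    + now apply subgeometric_reflected.
    + now apply subgeometric_reflected.
    + intros z Hz'. rewrite !ev_reflected, !Cmod_mult by assumption.
      assert (Q := Dd z Hz').
      assert (P := Cmod_ge_0 (RtoC s - Cconj zeta * RtoC (/ s) * z)). nra.
    + apply (sqnorm_reflected_le s zeta h dh); auto. lra.
    + eapply Rlt_le_trans; [exact Hlt|].
      rewrite (Eh O). unfold reflected. simpl mul_by_z.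
      replace (0 - zeta * dh O)%C with (- (zeta * dh O))%C by ring.
      replace (RtoC s * dh O + - (Cconj zeta * RtoC (/ s)) * 0)%C with
        (RtoC s * dh O)%C by ring.
      rewrite Cmod_opp, !Cmod_mult, Cmod_R, Rabs_pos_eq by lra.
      replace (2 * S n)%nat with (2 + 2 * n)%nat by lia. rewrite pow_add.
      rewrite <- Rmult_assoc. apply Rmult_le_compat_r.
      { apply pow_le, Rdiv_le_0_compat; lra. }
      replace ((s * Cmod (dh O)) ^ 2) with
        ((rho * Cmod (dh O)) ^ 2 * (s / rho) ^ 2) by (field; lra).
      apply Rmult_le_compat_r; [apply pow2_ge_0|]. apply pow_incr.
      assert (P := Cmod_ge_0 (dh O)). split.
      * apply Rmult_le_pos; [apply Cmod_ge_0|exact P].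
      * now apply Rmult_le_compat_r.
    + exists W. split; [exact W1|split; [exact W2|]].
      intros z Hz'. assert (Hz1' : Cmod z < 1) by lra.
      assert (Q := W3 z Hz'). rewrite !ev_reflected in Q by assumption.
      set (f := (RtoC s - Cconj zeta * RtoC (/ s) * z)%C) in *.
      assert (Nf : f <> 0).
      { intros E. assert (E' : RtoC s = (Cconj zeta * RtoC (/ s) * z)%C)
          by now apply Cminus_eq_0.
        apply (f_equal Cmod) in E'.
        rewrite !Cmod_mult, Cmod_conj, !Cmod_R in E'.
        rewrite !Rabs_pos_eq in E'
          by (try apply Rlt_le, Rinv_0_lt_compat; lra).
        assert (E2 : s * s = Cmod zeta * Cmod z).
        { rewrite E' at 1. field. lra. }
        assert (P1 := Cmod_ge_0 zeta). assert (P2 := Cmod_ge_0 z). nra. }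
      rewrite Fg, Fh by assumption.
      assert (Q' : ev dg z = (W z * ev dh z)%C).
      { replace (ev dg z) with (/ f * (f * ev dg z))%C by (field; exact Nf).
        rewrite Q. field. exact Nf. }
      rewrite Q'. ring.
Qed.

Lemma quotient_nonzero_const rho k g h :
  0 < rho < 1 -> 0 <= k -> subgeometric g -> subgeometric h ->
  dominated k g h -> h O <> 0 -> has_quotient rho k g h.
Proof.
  intros Hr Hk Hg Hh Hd Hne. set (s := (1 + rho) / 2).
  assert (Hs : rho < s < 1) by (unfold s; lra).
  destruct (sqnorm_bounded s h ltac:(lra) Hh) as [B HB].
  assert (P0 : 0 < Cmod (h O)) by now apply Cmod_gt_0.
  assert (P : 0 < Cmod (h O) ^ 2) by now apply pow_lt.
  assert (Q : 1 < s / rho).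
  { apply (Rmult_lt_reg_r rho); [lra|]. unfold Rdiv.
    rewrite Rmult_assoc, Rinv_l; lra. }
  destruct (Pow_x_infinity (s / rho)) with (b := B / Cmod (h O) ^ 2 + 1) as [n Hn].
  { rewrite Rabs_pos_eq; lra. }
  apply (quotient_by_removal rho s k n) with B; auto; try lra.
  specialize (Hn (2 * n)%nat ltac:(lia)).
  rewrite Rabs_pos_eq in Hn by (apply pow_le; lra).
  apply Rmult_lt_reg_r with (/ Cmod (h O) ^ 2); [now apply Rinv_0_lt_compat|].
  replace (Cmod (h O) ^ 2 * (s / rho) ^ (2 * n) * / Cmod (h O) ^ 2) with
    ((s / rho) ^ (2 * n)) by (field; lra).
  unfold Rdiv in *. lra.
Qed.

(** A zero of [h] at the centre has no reflection, but it is shared by [g] and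
    can be divided out by shifting both series; this ends at the first
    nonzero coefficient of [h]. *)
Lemma quotient_of_dominated rho k g h :
  0 < rho < 1 -> 0 <= k -> subgeometric g -> subgeometric h ->
  dominated k g h -> has_quotient rho k g h.
Proof.
  intros Hr Hk Hg Hh Hd.
  destruct (classic (exists m, h m <> 0)) as [[m Hm]|Hno].
  - revert g h Hg Hh Hd Hm. induction m as [|m IH]; intros g h Hg Hh Hd Hm.
    + now apply quotient_nonzero_const.
    + destruct (Ceq_dec (h O) 0) as [H0|H0];
        [|now apply quotient_nonzero_const].
      assert (G0 : g O = 0).
      { apply Cmod_eq_0. apply Rle_antisym; [|apply Cmod_ge_0].
        assert (Q := Hd 0 Cmod0_lt_1). rewrite !ev_0, H0, Cmod_0 in Q by assumption.
        lra. }
      assert (Fg : forall z, Cmod z < 1 -> ev g z = (z * ev (shift g) z)%C).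
      { intros z Hz. rewrite ev_shift, G0 by assumption. ring. }
      assert (Fh : forall z, Cmod z < 1 -> ev h z = (z * ev (shift h) z)%C).
      { intros z Hz. rewrite ev_shift, H0 by assumption. ring. }
      destruct (IH (shift g) (shift h)) as (W & W1 & W2 & W3);
        auto using subgeometric_shift.
      * apply dominated_punctured with (RtoC 0);
          auto using subgeometric_shift, Cmod0_lt_1.
        intros z Hz Hne. assert (Q := Hd z Hz).
        rewrite Fg, Fh, !Cmod_mult in Q by assumption.
        apply (Rmult_le_reg_l (Cmod z)); [now apply Cmod_gt_0|]. lra.
      * exists W. split; [exact W1|split; [exact W2|]]. intros z Hz.
        rewrite Fg, Fh, W3 by (auto; lra). ring.
  - assert (Hz : forall z, Cmod z < 1 -> ev h z = 0).
    { intros z Hz. apply ev_unique; auto.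
      apply clim_ext with (fun _ => RtoC 0); [|apply clim_const].
      intros n. unfold partial. rewrite (csum_ext _ (fun _ => RtoC 0)).
      - rewrite csum_const. ring.
      - intros i _. destruct (Ceq_dec (h i) 0) as [->|H]; [ring|].
        exfalso. apply Hno. now exists i. }
    exists (fun _ => RtoC 0). split; [apply smooth_const|split].
    + intros z _. now rewrite Cmod_0.
    + intros z Hz'. assert (Hz1 : Cmod z < 1) by lra.
      transitivity (RtoC 0); [|ring].
      apply Cmod_eq_0. apply Rle_antisym; [|apply Cmod_ge_0].
      eapply Rle_trans; [apply Hd, Hz1|]. rewrite Hz, Cmod_0 by exact Hz1. lra.
Qed.

(** Divide on the disk of radius [r] and let [r] tend to one. *)
Lemma sections_dominated k g h N :
  0 <= k -> subgeometric g -> subgeometric h -> dominated k g h ->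
  rsum (fun i => Cmod (g i) ^ 2) N <= k ^ 2 * rsum (fun i => Cmod (h i) ^ 2) N.
Proof.
  intros Hk Hg Hh Hd.
  assert (At1 : forall c, rsum (fun i => Cmod (c i) ^ 2 * 1 ^ (2 * i)) N
                          = rsum (fun i => Cmod (c i) ^ 2) N).
  { intros c. apply rsum_ext. intros i _. rewrite pow1. ring. }
  assert (Cont : forall c, continuity_pt
      (fun r => rsum (fun i => Cmod (c i) ^ 2 * r ^ (2 * i)) N) 1).
  { intros c. induction N as [|m IH].
    - apply continuity_pt_const. now intros x y.
    - apply (continuity_pt_plus
        (fun r => rsum (fun i => Cmod (c i) ^ 2 * r ^ (2 * i)) m)
        (fun r => Cmod (c m) ^ 2 * r ^ (2 * m))).
      + apply IH. intros c'. apply rsum_ext. intros i _. rewrite pow1. ring.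
      + apply derivable_continuous_pt, derivable_pt_scal, derivable_pt_pow. }
  assert (H := le_at_1
    (fun r => rsum (fun i => Cmod (g i) ^ 2 * r ^ (2 * i)) N
       - k ^ 2 * rsum (fun i => Cmod (h i) ^ 2 * r ^ (2 * i)) N) 0).
  cbv beta in H. rewrite !At1 in H.
  apply Rminus_le, H.
  - apply continuity_pt_minus; [apply Cont|].
    apply continuity_pt_scal, Cont.
  - intros r Hr.
    destruct (quotient_of_dominated r k g h Hr Hk Hg Hh Hd) as (W & W1 & W2 & W3).
    apply Rle_minus. apply section_contraction with W; auto. lra.
Qed.

(** * Analytic functions given by their coefficients *)

Lemma pow_n_Cpow (z : C) n : @pow_n C_Ring z n = (z ^ n)%C.
Proof. induction n as [|n IH]; [reflexivity|]. simpl. now rewrite IH. Qed.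

Lemma is_pseries_clim (c : nat -> C) (z l : C) :
  @is_pseries C_AbsRing C_NormedModule c z l <-> clim (partial c z) l.
Proof.
  unfold is_pseries, is_series.
  rewrite (@filterlim_locally_ball_norm C_AbsRing nat C_NormedModule
    eventually (@filter_filter _ _ eventually_filter)).
  rewrite clim_incr_1. unfold clim. rewrite <- is_lim_seq_spec.
  unfold ball_norm, is_lim_seq'.
  assert (E : forall n, Rabs (Cmod (partial c z (S n) - l) - 0) =
    @norm C_AbsRing C_NormedModule (minus (@sum_n C_NormedModule
       (fun k => scal (pow_n z k) (c k)) n) l)).
  { intros n. rewrite Rminus_0_r, Rabs_pos_eq by apply Cmod_ge_0.
    match goal with |- _ = @norm _ _ ?y => change (@norm _ _ y) with (Cmod y) end.
    f_equal.
    change (partial c z (S n) - l = @sum_n C_AbelianMonoid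
       (fun k => scal (pow_n z k) (c k)) n - l)%C.
    f_equal. rewrite sum_n_csum. unfold partial. apply csum_ext. intros i _.
    change (c i * z ^ i = @pow_n C_Ring z i * c i)%C.
    rewrite (pow_n_Cpow z i). ring. }
  split; intros H eps; destruct (H eps) as [N HN]; exists N; intros n Hn;
    specialize (HN n Hn); [rewrite E|rewrite <- E]; exact HN.
Qed.

Lemma clim_bounded u l : clim u l -> exists B, forall n, Cmod (u n) <= B.
Proof.
  intros H.
  destruct (filterlim_bounded (K := R_AbsRing) (V := R_NormedModule)
    (fun n => Cmod (u n - l))) as [M HM].
  { exists 0. exact H. }
  exists (Cmod l + M). intros n.
  eapply Rle_trans; [apply (Cmod_le_plus _ l)|].
  specialize (HM n). change (Rabs (Cmod (u n - l)) <= M) in HM.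
  assert (P := Rle_abs (Cmod (u n - l))). lra.
Qed.

Lemma subgeometric_of_clim c :
  (forall z, Cmod z < 1 -> exists l, clim (partial c z) l) -> subgeometric c.
Proof.
  intros H t Ht. destruct (H (RtoC t)) as [l Hl].
  { rewrite Cmod_R, Rabs_pos_eq; lra. }
  destruct (clim_bounded _ _ Hl) as [B HB]. exists (B + B). intros n.
  replace (Cmod (c n) * t ^ n) with
    (Cmod (partial c (RtoC t) (S n) - partial c (RtoC t) n)).
  - eapply Rle_trans; [apply Cmod_triangle|]. rewrite Cmod_opp.
    apply Rplus_le_compat; apply HB.
  - unfold partial. simpl.
    replace (csum (fun i => c i * RtoC t ^ i) n + c n * RtoC t ^ n
       - csum (fun i => c i * RtoC t ^ i) n)%C with (c n * RtoC t ^ n)%C by ring.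
    rewrite Cmod_mult, Cmod_pow, Cmod_R, Rabs_pos_eq; lra.
Qed.

Lemma is_derive_of_remainder (f : C -> C) (z l : C) (K d : R) :
  0 < d ->
  (forall w, Cmod (w - z) < d ->
     Cmod (f w - f z - l * (w - z)) <= K * Cmod (w - z) ^ 2) ->
  @is_derive C_AbsRing C_NormedModule f z l.
Proof.
  intros Hd H. split; [apply is_linear_scal_l|].
  intros x Hx eps.
  apply (@is_filter_lim_locally_unique C_AbsRing
           (AbsRing_NormedModule C_AbsRing)) in Hx. subst x.
  assert (Pe := cond_pos eps). assert (PK := Rabs_pos K).
  assert (He : 0 < Rmin d (eps / (Rabs K + 1))).
  { apply Rmin_glb_lt; [exact Hd|]. apply Rdiv_lt_0_compat; lra. }
  exists (mkposreal _ He). intros w Hw.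
  change (Cmod (w - z) < Rmin d (eps / (Rabs K + 1))) in Hw.
  change (Cmod (f w - f z - (w - z) * l) <= eps * Cmod (w - z)).
  replace ((w - z) * l)%C with (l * (w - z))%C by ring.
  assert (W1 := Rlt_le_trans _ _ _ Hw (Rmin_l _ _)).
  assert (W2 := Rlt_le_trans _ _ _ Hw (Rmin_r _ _)).
  eapply Rle_trans; [apply H, W1|].
  assert (P := Cmod_ge_0 (w - z)). set (D := Cmod (w - z)) in *.
  replace (K * D ^ 2) with (K * D * D) by ring.
  apply Rmult_le_compat_r; [exact P|].
  apply Rle_trans with ((Rabs K + 1) * D).
  - apply Rmult_le_compat_r; [exact P|]. assert (Q := Rle_abs K). lra.
  - apply Rle_trans with ((Rabs K + 1) * (eps / (Rabs K + 1))).
    + apply Rmult_le_compat_l; lra.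
    + right. field. lra.
Qed.

Lemma is_derive_ev (f : C -> C) c z :
  subgeometric c -> (forall w, Cmod w < 1 -> f w = ev c w) -> Cmod z < 1 ->
  @is_derive C_AbsRing C_NormedModule f z (ev (dcoef c) z).
Proof.
  intros Hc Hf Hz. set (r := (1 + Cmod z) / 2).
  destruct (smooth_with_ev r c ltac:(unfold r; lra) Hc) as [K HK].
  apply (is_derive_of_remainder f z _ K ((1 - Cmod z) / 2)); [lra|].
  intros w Hw.
  assert (B : Cmod w <= r).
  { assert (Q := Cmod_le_plus w z). unfold r. lra. }
  rewrite !Hf by (unfold r in *; lra).
  apply HK; [unfold r; lra|exact B].
Qed.

Lemma analytic_with_coeffs_spec f c :
  analytic_with_coeffs f c ->
  subgeometric c /\
  (forall z, Cmod z < 1 -> f z = ev c z) /\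
  (forall z, Cmod z < 1 -> C_derive f z = ev (dcoef c) z).
Proof.
  intros [_ H].
  assert (Hc : subgeometric c).
  { apply subgeometric_of_clim. intros z Hz. exists (f z).
    apply is_pseries_clim. now apply H. }
  assert (Hf : forall z, Cmod z < 1 -> f z = ev c z).
  { intros z Hz. symmetry. apply ev_unique; auto.
    apply is_pseries_clim. now apply H. }
  split; [exact Hc|split; [exact Hf|]].
  intros z Hz. apply is_C_derive_unique. now apply is_derive_ev.
Qed.

Lemma analytic_ev c : subgeometric c -> analytic_with_coeffs (ev c) c.
Proof.
  intros Hc. split; intros z Hz.
  - exists (ev (dcoef c) z). apply is_derive_ev; auto.
  - apply is_pseries_clim. now apply ev_correct.
Qed.

(** * Weighted sums *)

(** Abel summation: [y - x] has nonnegative partial sums, and a decreasing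
    weight turns the weighted sum into a nonnegative combination of them. *)
Lemma abel_compare (x y w : nat -> R) N :
  (forall i, 0 <= w i) -> (forall i, w (S i) <= w i) ->
  (forall n, rsum x n <= rsum y n) ->
  rsum (fun i => x i * w i) N <= rsum (fun i => y i * w i) N.
Proof.
  intros Hw Hdec H.
  assert (K : forall n, w n * (rsum y n - rsum x n) <=
     rsum (fun i => y i * w i) n - rsum (fun i => x i * w i) n).
  { induction n as [|n IH]; simpl; [lra|].
    assert (Q := H (S n)). simpl in Q. assert (D := Hdec n).
    apply Rle_trans with (w n * (rsum y n + y n - (rsum x n + x n))); [|lra].
    apply Rmult_le_compat_r; lra. }
  assert (P : 0 <= w N * (rsum y N - rsum x N)).
  { apply Rmult_le_pos; [apply Hw|]. specialize (H N). lra. }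
  specialize (K N). lra.
Qed.

(** The expansion of [rsum w (x - t)^2 >= 0] at [t = T]; when [T = 0] a small
    positive [t] does. *)
Lemma weighted_mean_le (x w : nat -> R) T N :
  0 <= T -> (forall i, 0 <= w i) ->
  rsum (fun i => x i ^ 2 * w i) N <= T ^ 2 * rsum w N ->
  rsum (fun i => x i * w i) N <= T * rsum w N.
Proof.
  intros HT Hw H.
  assert (Q : forall t, 0 <= rsum (fun i => x i ^ 2 * w i) N
     - 2 * t * rsum (fun i => x i * w i) N + t ^ 2 * rsum w N).
  { intros t.
    replace (rsum (fun i => x i ^ 2 * w i) N
     - 2 * t * rsum (fun i => x i * w i) N + t ^ 2 * rsum w N) with
      (rsum (fun i => (x i - t) ^ 2 * w i) N).
    - apply rsum_nonneg. intros i _. apply Rmult_le_pos; [apply pow2_ge_0|apply Hw].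
    - clear H. induction N as [|N IH]; simpl; [ring|]. simpl in IH. rewrite IH. ring. }
  set (X := rsum (fun i => x i * w i) N) in *.
  set (Phi := rsum w N) in *.
  assert (PPhi : 0 <= Phi) by (apply rsum_nonneg; auto).
  destruct (Rle_lt_or_eq_dec 0 T HT) as [PT|ET].
  - specialize (Q T). apply (Rmult_le_reg_l (2 * T)); [lra|]. simpl in Q, H. lra.
  - subst T. rewrite Rmult_0_l. apply Rnot_lt_le. intros PX.
    specialize (Q (X / (Phi + 1))).
    set (v := X / (Phi + 1)) in *.
    assert (Pv : 0 < v) by (apply Rdiv_lt_0_compat; lra).
    assert (EX : X = v * (Phi + 1)) by (unfold v; field; lra).
    rewrite EX in Q. simpl in Q, H. nra.
Qed.

Lemma series_of_bounded_sums (u : nat -> R) B :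
  (forall i, 0 <= u i) -> (forall n, rsum u n <= B) ->
  ex_series u /\ Series u <= B.
Proof.
  intros Hu HB.
  assert (E : ex_series u).
  { destruct (ex_finite_lim_seq_incr (sum_n u) B) as [l Hl].
    - intros n. rewrite sum_Sn. unfold plus. simpl. specialize (Hu (S n)). lra.
    - intros n. rewrite sum_n_rsum. apply HB.
    - exists l. exact Hl. }
  split; [exact E|].
  apply (is_lim_seq_le (sum_n u) (fun _ => B) (Series u) B).
  - intros n. rewrite sum_n_rsum. apply HB.
  - exact (Series_correct _ E).
  - apply is_lim_seq_const.
Qed.

(** * The inequality *)

(** Tangent lines of [exp] at [p ln a], evaluated at [ln a] and at [0]. *)
Lemma Rpower_le_affine a p :
  0 < a -> 0 <= p <= 1 -> Rpower a p <= 1 - p * (1 - a).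
Proof.
  intros Ha Hp. unfold Rpower. set (x := ln a).
  assert (Ex : exp x = a) by (apply exp_ln; exact Ha).
  assert (T : forall y, exp (p * x) * (1 + (y - p * x)) <= exp y).
  { intros y. replace (exp y) with (exp (p * x) * exp (y - p * x)).
    - apply Rmult_le_compat_l; [apply Rlt_le, exp_pos|]. apply exp_ineq1_le.
    - rewrite <- exp_plus. f_equal. ring. }
  assert (T1 := T x). assert (T0 := T 0). rewrite Ex in T1. rewrite exp_0 in T0.
  assert (p * (exp (p * x) * (1 + (x - p * x))) <= p * a)
    by (apply Rmult_le_compat_l; lra).
  assert ((1 - p) * (exp (p * x) * (1 + (0 - p * x))) <= (1 - p) * 1)
    by (apply Rmult_le_compat_l; lra).
  lra.
Qed.

(** Two uses of [1 + x <= exp x], at [p ln a] and at [- ln a].  The bound has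
    the same slope at [a = 1] as [Rpower_le_affine]: this makes the constant
    [2 / p] the critical one. *)
Lemma Rpower_ge_affine a p :
  0 < a -> 0 <= p -> 1 - p * ((1 - a) / a) <= Rpower a p.
Proof.
  intros Ha Hp. unfold Rpower.
  assert (L : 1 + - ln a <= / a).
  { rewrite <- (exp_ln (/ a)) by now apply Rinv_0_lt_compat.
    rewrite ln_Rinv by exact Ha. apply exp_ineq1_le. }
  eapply Rle_trans; [|apply exp_ineq1_le].
  assert (E : (1 - a) / a = / a - 1) by (field; lra). rewrite E.
  assert (p * (1 + - ln a) <= p * / a) by (apply Rmult_le_compat_l; lra). lra.
Qed.

(** The bound on [b] is not available term by term from the bound on [a].  The
    hypothesis compares sums of [n^2 |b_n|^2] and [n^2 |a_n|^2] over initial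
    segments; decreasing weights [w / n^2] transfer this to the weighted sums
    of squares, and the Cauchy-Schwarz inequality to the sums themselves. *)
Lemma coefficient_sums k h g a b (w : nat -> R) N :
  0 <= k -> admissible_pair k h g a b ->
  (forall i, 0 <= w i) -> (forall i, w (S i) <= w i) ->
  rsum (fun i => Cmod (a (S i)) * w i) N
    <= 2 * (1 - Re (a O)) * rsum w N /\
  rsum (fun i => Cmod (b (S i)) * w i) N
    <= k * (2 * (1 - Re (a O))) * rsum w N.
Proof.
  intros Hk (Hh & Hg & Hd & Hre & _ & _ & _) Hw Hdec.
  destruct (analytic_with_coeffs_spec h a Hh) as (Ha & Eh & Dh).
  destruct (analytic_with_coeffs_spec g b Hg) as (Hb & Eg & Dg).
  set (A := 2 * (1 - Re (a O))).
  assert (HA : forall n, Cmod (a (S n)) <= A).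
  { intros n. apply caratheodory; [exact Ha|].
    intros z Hz. rewrite <- Eh by exact Hz. now apply Hre. }
  assert (PA : 0 <= A) by (eapply Rle_trans; [apply Cmod_ge_0|apply (HA O)]).
  split.
  - rewrite <- rsum_scal. apply rsum_le. intros i _.
    apply Rmult_le_compat_r; [apply Hw|apply HA].
  - apply weighted_mean_le; [apply Rmult_le_pos; assumption|exact Hw|].
    set (v := fun i => w i / INR (S i) ^ 2).
    assert (Pi : forall i, 0 < INR (S i)) by (intros i; apply lt_0_INR; lia).
    assert (D : dominated k (dcoef b) (dcoef a)).
    { intros z Hz. rewrite <- Dh, <- Dg by exact Hz. now apply Hd. }
    assert (E : forall c : nat -> C,
      rsum (fun i => Cmod (c (S i)) ^ 2 * w i) N =
      rsum (fun i => Cmod (dcoef c i) ^ 2 * v i) N).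
    { intros c. apply rsum_ext. intros i _. unfold dcoef, v.
      rewrite Cmod_mult, Cmod_R, Rabs_pos_eq by apply pos_INR.
      specialize (Pi i). field. lra. }
    apply Rle_trans with
      (rsum (fun i => (k ^ 2 * Cmod (dcoef a i) ^ 2) * v i) N).
    + rewrite E. apply abel_compare.
      * intros i. apply Rdiv_le_0_compat; [apply Hw|]. apply pow_lt, Pi.
      * intros i. unfold v, Rdiv. apply Rmult_le_compat.
        -- apply Hw.
        -- apply Rlt_le, Rinv_0_lt_compat, pow_lt, Pi.
        -- apply Hdec.
        -- apply Rinv_le_contravar; [apply pow_lt, Pi|].
           apply pow_incr. split; [apply Rlt_le, Pi|]. apply le_INR. lia.
      * intros n. rewrite rsum_scal.
        apply sections_dominated; auto using subgeometric_dcoef.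
    + rewrite (rsum_ext _ (fun i => k ^ 2 * (Cmod (dcoef a i) ^ 2 * v i)))
        by (intros; ring).
      rewrite rsum_scal, <- E.
      replace ((k * A) ^ 2 * rsum w N) with (k ^ 2 * (A ^ 2 * rsum w N)) by ring.
      apply Rmult_le_compat_l; [apply pow2_ge_0|].
      rewrite <- rsum_scal. apply rsum_le. intros i _.
      apply Rmult_le_compat_r; [apply Hw|]. apply pow_incr.
      split; [apply Cmod_ge_0|apply HA].
Qed.

Lemma bohr_inequality_of_Phi1 k p h g a b phi r :
  0 <= k -> 0 < p <= 1 -> class_F phi -> decreasing_seq phi ->
  in_unit_interval r -> 2 / p * (1 + k) * Phi1 phi r <= 1 ->
  admissible_pair k h g a b -> bohr_inequality p phi a b r.
Proof.
  intros Hk Hp (F1 & F2 & _) Hdec Hr HPhi Hadm.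
  set (w := fun i => phi (S i) r).
  assert (Hw : forall i, 0 <= w i).
  { intros i. apply (proj1 (F1 (S i) ltac:(lia))). exact Hr. }
  assert (Hwd : forall i, w (S i) <= w i).
  { intros i. apply Hdec; [lia|exact Hr]. }
  assert (Hsum : forall N, rsum w N <= Phi1 phi r).
  { intros N. apply Series_ge_rsum; [exact Hw|]. now apply F2. }
  assert (HC := fun N => coefficient_sums k h g a b w N Hk Hadm Hw Hwd).
  destruct Hadm as (_ & _ & _ & Hre & Ha0 & _ & Hpos).
  assert (Hle1 : Re (a O) <= 1).
  { rewrite <- Ha0. apply Hre. exact Cmod0_lt_1. }
  set (A := 2 * (1 - Re (a O))) in *.
  assert (PA : 0 <= A) by (unfold A; lra).
  assert (PkA : 0 <= k * A) by (apply Rmult_le_pos; assumption).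
  destruct (series_of_bounded_sums (fun i => Cmod (a (S i)) * w i)
    (A * Phi1 phi r)) as [Ea La].
  { intros i. apply Rmult_le_pos; [apply Cmod_ge_0|apply Hw]. }
  { intros N. eapply Rle_trans; [apply HC|]. apply Rmult_le_compat_l; auto. }
  destruct (series_of_bounded_sums (fun i => Cmod (b (S i)) * w i)
    (k * A * Phi1 phi r)) as [Eb Lb].
  { intros i. apply Rmult_le_pos; [apply Cmod_ge_0|apply Hw]. }
  { intros N. eapply Rle_trans; [apply HC|]. apply Rmult_le_compat_l; auto. }
  split; [exact Ea|split; [exact Eb|]]. fold w.
  assert (HP := Rpower_le_affine (Re (a O)) p Hpos ltac:(lra)).
  assert (H2 : 2 * (1 + k) * Phi1 phi r <= p).
  { replace (2 * (1 + k) * Phi1 phi r) with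
      (p * (2 / p * (1 + k) * Phi1 phi r)) by (field; lra).
    apply Rle_trans with (p * 1); [apply Rmult_le_compat_l|]; lra. }
  assert (H3 : (1 - Re (a O)) * (2 * (1 + k) * Phi1 phi r) <= (1 - Re (a O)) * p).
  { apply Rmult_le_compat_l; lra. }
  unfold w in *. unfold A in *. lra.
Qed.

(** * Extremal functions *)

(** Coefficients of the map [al - 2 (1 - al) z / (1 - z)] of the disk onto the
    half-plane [Re < 1]. *)
Definition half_plane_coef (al : R) (n : nat) : C :=
  match n with O => RtoC al | S _ => RtoC (-2 * (1 - al)) end.

Lemma subgeometric_bounded c B : (forall n, Cmod (c n) <= B) -> subgeometric c.
Proof.
  intros H t Ht. exists B. intros n. rewrite <- (Rmult_1_r B).
  apply Rmult_le_compat; [apply Cmod_ge_0|apply pow_le; lra|apply H|].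
  rewrite <- (pow1 n). apply pow_incr. lra.
Qed.

Lemma subgeometric_half_plane al : subgeometric (half_plane_coef al).
Proof.
  apply subgeometric_bounded with (Rabs al + Rabs (-2 * (1 - al))).
  assert (P := Rabs_pos al). assert (P' := Rabs_pos (-2 * (1 - al))).
  intros [|n]; simpl half_plane_coef; rewrite Cmod_R; lra.
Qed.

Lemma Re_half_plane_le al z :
  al <= 1 -> Cmod z < 1 -> Re (ev (half_plane_coef al) z) <= 1.
Proof.
  intros Hal Hz.
  set (ones := fun _ : nat => RtoC 1).
  assert (Ho : subgeometric ones).
  { apply subgeometric_bounded with 1. intros n. unfold ones. rewrite Cmod_1. lra. }
  set (e := ev ones z).
  assert (He : e = (1 + z * e)%C) by exact (ev_shift ones z Ho Hz).
  assert (He' : (e * (1 - z))%C = RtoC 1).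
  { transitivity (e - z * e)%C; [ring|]. rewrite He at 1. ring. }
  rewrite ev_shift by (auto using subgeometric_half_plane).
  replace (shift (half_plane_coef al)) with
    (fun n => RtoC (-2 * (1 - al)) * ones n)%C.
  2:{ apply functional_extensionality. intros n. unfold ones, shift. simpl. ring. }
  rewrite ev_scal by assumption. fold e. simpl half_plane_coef.
  assert (K : 0 <= Re (e * (1 + z))).
  { (* [e] is the inverse of [1 - z], so [e = |e|^2 conj (1 - z)] *)
    assert (E1 : (e * (1 + z))%C
       = (RtoC (Cmod e ^ 2) * ((1 + z) * Cconj (1 - z)))%C).
    { rewrite Cmod2_conj.
      replace (e * Cconj e * ((1 + z) * Cconj (1 - z)))%C with
        (e * (1 + z) * (Cconj e * Cconj (1 - z)))%C by ring.
      rewrite <- Cmult_conj, He', Cconj_R. ring. }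
    rewrite E1, re_scal_l. apply Rmult_le_pos; [apply pow2_ge_0|].
    assert (E2 : Re ((1 + z) * Cconj (1 - z)) = 1 - Cmod z ^ 2).
    { rewrite Cmod2_alt. destruct z as [x y].
      unfold Cconj, Cmult, Cplus, Cminus, Copp, Re, Im, RtoC. simpl. ring. }
    rewrite E2. assert (P := Cmod_ge_0 z). nra. }
  replace (e * (1 + z))%C with (1 + 2 * (z * e))%C in K.
  2:{ transitivity (e + z * e)%C; [rewrite He at 2|]; ring. }
  rewrite re_plus, re_scal_l, re_RtoC in K.
  replace (z * (RtoC (-2 * (1 - al)) * e))%C with
    (RtoC (-2 * (1 - al)) * (z * e))%C by ring.
  rewrite re_plus, re_scal_l, re_RtoC. nra.
Qed.

Lemma half_plane_admissible k al :
  0 <= k -> 0 < al <= 1 ->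
  admissible_pair k (ev (half_plane_coef al))
    (ev (fun n => RtoC k * half_plane_coef al n)%C)
    (half_plane_coef al) (fun n => RtoC k * half_plane_coef al n)%C.
Proof.
  intros Hk Hal.
  assert (Ha := subgeometric_half_plane al).
  assert (Hb := subgeometric_scal (RtoC k) _ Ha).
  assert (Aa := analytic_ev _ Ha). assert (Ab := analytic_ev _ Hb).
  split; [exact Aa|split; [exact Ab|split; [|split; [|split; [|split]]]]].
  - intros z Hz.
    destruct (analytic_with_coeffs_spec _ _ Aa) as (_ & _ & Da).
    destruct (analytic_with_coeffs_spec _ _ Ab) as (_ & _ & Db).
    rewrite Da, Db by exact Hz.
    replace (dcoef (fun n => RtoC k * half_plane_coef al n)%C) with
      (fun n => RtoC k * dcoef (half_plane_coef al) n)%C.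
    + rewrite ev_scal, Cmod_mult, Cmod_R, Rabs_pos_eq
        by (auto using subgeometric_dcoef). lra.
    + apply functional_extensionality. intros n. unfold dcoef. ring.
  - intros z Hz. apply Re_half_plane_le; [lra|exact Hz].
  - now apply ev_0.
  - reflexivity.
  - simpl. lra.
Qed.

(** As [al] tends to one, [Rpower al p] falls short of [1] by about
    [p (1 - al)], while the two series contribute exactly
    [2 (1 + k) (1 - al) Phi1]; the latter wins once [al] exceeds
    [p / (2 (1 + k) Phi1)]. *)
Lemma half_plane_violates k p phi r :
  0 <= k -> 0 < p <= 1 -> 1 < 2 / p * (1 + k) * Phi1 phi r ->
  exists al, 0 < al <= 1 /\
    ~ bohr_inequality p phi (half_plane_coef al)
        (fun n => RtoC k * half_plane_coef al n)%C r.
Proof.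
  intros Hk Hp HPhi. set (S1 := 2 * (1 + k) * Phi1 phi r).
  assert (HS : p < S1).
  { unfold S1. replace (2 * (1 + k) * Phi1 phi r) with
      (p * (2 / p * (1 + k) * Phi1 phi r)) by (field; lra).
    apply Rle_lt_trans with (p * 1); [|apply Rmult_lt_compat_l]; lra. }
  set (q := p / S1).
  assert (Hq : 0 < q < 1).
  { unfold q. split; [apply Rdiv_lt_0_compat; lra|].
    apply (Rmult_lt_reg_r S1); [lra|]. unfold Rdiv.
    rewrite Rmult_assoc, Rinv_l; lra. }
  set (al := (1 + q) / 2).
  assert (Hal : q < al < 1) by (unfold al; lra).
  exists al. split; [lra|]. intros (_ & _ & H).
  assert (E1 : Series (fun n => Cmod (half_plane_coef al (S n)) * phi (S n) r)
               = 2 * (1 - al) * Phi1 phi r).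
  { unfold Phi1. rewrite <- Series_scal_l. apply Series_ext. intros n.
    simpl half_plane_coef. rewrite Cmod_R. f_equal.
    rewrite Rabs_left; lra. }
  assert (E2 : Series (fun n => Cmod (RtoC k * half_plane_coef al (S n)) * phi (S n) r)
               = k * (2 * (1 - al)) * Phi1 phi r).
  { unfold Phi1. rewrite <- Series_scal_l. apply Series_ext. intros n.
    simpl half_plane_coef. rewrite Cmod_mult, !Cmod_R.
    rewrite (Rabs_pos_eq k), Rabs_left by lra. ring. }
  rewrite E1, E2 in H. simpl half_plane_coef in H. rewrite re_RtoC in H.
  assert (G := Rpower_ge_affine al p ltac:(lra) ltac:(lra)).
  assert (Ep : p = q * S1) by (unfold q; field; lra).
  assert (L : p * ((1 - al) / al) < (1 - al) * S1).
  { replace (p * ((1 - al) / al)) with ((1 - al) * (q * S1 / al))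
      by (rewrite Ep; field; lra).
    apply Rmult_lt_compat_l; [lra|].
    apply (Rmult_lt_reg_r al); [lra|].
    replace (q * S1 / al * al) with (S1 * q) by (field; lra).
    apply Rmult_lt_compat_l; lra. }
  unfold S1 in L. lra.
Qed.

Theorem theorem7 :
  forall (k p r0 : R) (phi : nat -> R -> R),
    0 <= k <= 1 ->
    0 < p <= 1 ->
    class_F phi ->
    decreasing_seq phi ->
    minimal_positive_root (fun x => 2 / p * (1 + k) * Phi1 phi x) r0 ->
    (forall r, 0 <= r < r0 -> 1 > 2 / p * (1 + k) * Phi1 phi r) ->
    (forall (h g : C -> C) (a b : nat -> C),
        admissible_pair k h g a b ->
        forall r, 0 <= r <= r0 -> bohr_inequality p phi a b r)
    /\
    (forall eps : R,
        0 < eps -> r0 + eps <= 1 ->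
        (forall x, r0 < x < r0 + eps -> 1 < 2 / p * (1 + k) * Phi1 phi x) ->
        ~ exists r1 : R,
            r0 < r1 < 1 /\
            (forall (h g : C -> C) (a b : nat -> C),
                admissible_pair k h g a b ->
                forall r, 0 <= r <= r1 -> bohr_inequality p phi a b r)).
Proof.
  intros k p r0 phi Hk Hp HF Hdec (Hr0 & Hroot & _) Hlt. split.
  - intros h g a b Hadm r Hr.
    apply (bohr_inequality_of_Phi1 k p h g a b); auto; try lra.
    + unfold in_unit_interval. lra.
    + destruct (Rle_lt_or_eq_dec r r0 (proj2 Hr)) as [H|H].
      * apply Rlt_le, Hlt. lra.
      * rewrite H. lra.
  - intros eps Heps _ Hgt (r1 & Hr1 & Hall).
    set (x := (r0 + Rmin r1 (r0 + eps)) / 2).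
    assert (Hx : r0 < x < r0 + eps /\ x <= r1).
    { assert (M1 := Rmin_l r1 (r0 + eps)). assert (M2 := Rmin_r r1 (r0 + eps)).
      assert (M3 : r0 < Rmin r1 (r0 + eps)) by (apply Rmin_glb_lt; lra).
      unfold x. lra. }
    destruct (half_plane_violates k p phi x) as (al & Hal & Hno); try lra.
    { apply Hgt. lra. }
    apply Hno. apply (Hall _ _ _ _ (half_plane_admissible k al ltac:(lra) Hal)).
    lra.
Qed.
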